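(* Let $k\in\{2,3,4\}$, and let $\beta>1$ if $k\in\{2,3\}$, $\beta\ge2$ if $k=4$. Let $V,H,\mathcal{L},\mathcal{G},f$ be as in the context, and let $\phi(\cdot)$ be the exact solution of $\phi_t+\mathcal{L}\phi+\mathcal{G}[\phi]=f$, $0<t<T$, with $\phi(0)\in V$. Assume: (a) the local Lipschitz condition: with a non-negative constant $\gamma$ and an arbitrary constant $\mu$, $$\|\mathcal{G}(v)-\mathcal{G}(\tilde v)\|_\star^2\le\gamma\|v-\tilde v\|^2+\mu|v-\tilde v|^2\qquad\forall v,\tilde v\in\mathcal{B}_{\phi(t)},\ \forall t\in[0,T],$$ where $\mathcal{B}_{\phi(t)}=\{v\in V:\|v-\phi(t)\|\le1\}$; (b) the exact solution is sufficiently smooth that the truncation errors defined in the context satisfy $|E_k^{n+1}|^2\le C(\Delta t)^{2k+2}$, $\|R_k^{n+1}\|^2\le C(\Delta t)^{2k}$, $\|P_k^n\|^2\le C(\Delta t)^{2k}$ for all $n+1\le T/\Delta t$; (c) the stability condition $\eta_k(\beta)-\sqrt{\gamma}\ge\rho>0$ is satisfied; (d) $\phi^0=\phi(0)$, and $\phi^1,\dots,\phi^{k-1}$ are computed with a proper initialization procedure such that $|\phi^i-\phi(t^i)|^2\le C(\Delta t)^{2k}$ and $\|\phi^i-\phi(t^i)\|^2\le C(\Delta t)^{2k}$ for $i=1,\dots,k-1$, and $C_k^\beta(\phi^{k-1})\in\mathcal{B}_{\phi(t^{k-1+\beta})}$. Let $\phi^{n+1}$ (for $n+1\ge k$) be determined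 by $$\frac{1}{\Delta t}A_k^\beta(\phi^{n+1})+\mathcal{L}B_k^\beta(\phi^{n+1})+\mathcal{G}\big(C_k^\beta(\phi^n)\big)=f(t^{n+\beta}),$$ and set $e^m=\phi^m-\phi(t^m)$. Then for $\Delta t$ sufficiently small, $$C_k^\beta(\phi^{n+1})\in\mathcal{B}_{\phi(t^{n+1+\beta})},\qquad\forall\,n+1\le\frac{T}{\Delta t},$$ and $$g_k|e^{n+1}|^2+\frac{\rho}{2}\Delta t\sum_{q=k-1}^{n+1}\|C_k^\beta(e^q)\|^2\le C\exp\big((1-C\Delta t)^{-1}T\big)(\Delta t)^{2k},\qquad\forall\,n+1\le\frac{T}{\Delta t},$$ where $g_k$ is a positive constant depending only on $k$ and $C$ is a constant independent of $\Delta t$.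
   Context: Functional setting: $V\subset H=H'\subset V'$ are real Hilbert spaces with $V$ densely and continuously embedded in $H$, and $V'$ the dual of $V$. $(\cdot,\cdot)$ and $|\cdot|$ are the inner product and norm of $H$; $(\cdot,\cdot)$ also denotes the duality pairing between $V'$ and $V$. $\mathcal{L}:V\to V'$ is a positive definite, self-adjoint linear operator, and the norm of $V$ is $\|u\|=(\mathcal{L}u,u)^{1/2}$. The dual norm is $\|v\|_\star=\sup_{u\in V\setminus\{0\}}|(v,u)|/\|u\|$ for $v\in V'$. $\mathcal{G}$ is a nonlinear operator with values in $V'$ and $f$ is a $V'$-valued source term. Notation: $\Delta t$ is the time step and $t^{s}=s\Delta t$ for real $s$. For a sequence, $A_k^\beta(\phi^i)=\sum_{q=0}^{k}a_{k,q}\phi^{i-k+q}$, $B_k^\beta(\phi^i)=\sum_{q=0}^{k-1}b_{k,q}\phi^{i-k+1+q}$, $C_k^\beta(\phi^i)=\sum_{q=0}^{k-1}c_{k,q}\phi^{i-k+1+q}$; the same notation applied to $\phi(t^i)$ uses the sequence of exact values $\phi(t^j)$. Truncation errors: $E_k^{n+1}=\Delta t\,\phi_t(t^{n+\beta})-A_k^\beta(\phi(t^{n+1}))$, $R_k^{n+1}=\phi(t^{n+\beta})-B_k^\beta(\phi(t^{n+1}))$, $P_k^n=\phi(t^{n+\beta})-C_k^\beta(\phi(t^n))$. Also $\eta_2(\beta)=\frac{\beta-1}{\beta}$, $\eta_3(\beta)=\frac{\beta-1}{\beta+1}$, $\eta_4(\beta)=\frac{\beta-1}{\beta+3}$. Coefficients: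 $k=2$: $a_{2,2}=\frac{2\beta+1}{2}$, $a_{2,1}=-2\beta$, $a_{2,0}=\frac{2\beta-1}{2}$; $b_{2,1}=\beta$, $b_{2,0}=-(\beta-1)$; $c_{2,1}=\beta+1$, $c_{2,0}=-\beta$. $k=3$: $a_{3,3}=\frac{3\beta^2+6\beta+2}{6}$, $a_{3,2}=-\frac{9\beta^2+12\beta-3}{6}$, $a_{3,1}=\frac{9\beta^2+6\beta-6}{6}$, $a_{3,0}=-\frac{3\beta^2-1}{6}$; $b_{3,2}=\frac{\beta^2+\beta}{2}$, $b_{3,1}=-(\beta^2-1)$, $b_{3,0}=\frac{\beta^2-\beta}{2}$; $c_{3,2}=\frac{\beta^2+3\beta+2}{2}$, $c_{3,1}=-(\beta^2+2\beta)$, $c_{3,0}=\frac{\beta^2+\beta}{2}$. $k=4$: $a_{4,4}=\frac{2\beta^3+9\beta^2+11\beta+3}{12}$, $a_{4,3}=\frac{-8\beta^3-30\beta^2-20\beta+10}{12}$, $a_{4,2}=\frac{12\beta^3+36\beta^2+6\beta-18}{12}$, $a_{4,1}=\frac{-8\beta^3-18\beta^2+4\beta+6}{12}$, $a_{4,0}=\frac{2\beta^3+3\beta^2-\beta-1}{12}$; $b_{4,3}=\frac{\beta^3+3\beta^2+2\beta}{6}$, $b_{4,2}=\frac{-\beta^3-2\beta^2+\beta+2}{2}$, $b_{4,1}=\frac{\beta^3+\beta^2-2\beta}{2}$, $b_{4,0}=\frac{-\beta^3+\beta}{6}$; $c_{4,3}=\frac{\beta^3+6\beta^2+11\beta+6}{6}$,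 $c_{4,2}=\frac{-\beta^3-5\beta^2-6\beta}{2}$, $c_{4,1}=\frac{\beta^3+4\beta^2+3\beta}{2}$, $c_{4,0}=\frac{-\beta^3-3\beta^2-2\beta}{6}$.
   Formalization: Since φ and f are evaluated at times t^{n+β}, t^{n+1+β} beyond T, the exact solution is assumed on a slightly larger interval [0,T_1), T_1>T, continuous in time with values in V and differentiable with values in H. *)

(* Defs.v *)
From mathcomp Require Export all_boot all_order all_algebra.
From mathcomp Require Export sesquilinear.
From mathcomp Require Export all_classical all_reals all_analysis.
Set Implicit Arguments.
Unset Strict Implicit.
Unset Printing Implicit Defensive.
Export Order.TTheory GRing.Theory Num.Theory numFieldNormedType.Exports.
#[export] Set Implicit Arguments.
#[export] Unset Strict Implicit.
#[export] Unset Printing Implicit Defensive.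

Local Open Scope classical_set_scope.
Local Open Scope ring_scope.

(* Coefficient lists, in increasing order of q: the q-th entries are
   a_{k,q} (q <= k), b_{k,q} and c_{k,q} (q < k); only k = 2, 3, 4 matter. *)
Section Coefficients.
Context {R : realType}.
Implicit Types (k : nat) (beta : R).

Definition acoef k beta : seq R :=
  match k with
  | 2 => [:: (2 * beta - 1) / 2; - (2 * beta); (2 * beta + 1) / 2]
  | 3 => [:: - ((3 * beta ^+ 2 - 1) / 6);
             (9 * beta ^+ 2 + 6 * beta - 6) / 6;
             - ((9 * beta ^+ 2 + 12 * beta - 3) / 6);
             (3 * beta ^+ 2 + 6 * beta + 2) / 6]
  | 4 => [:: (2 * beta ^+ 3 + 3 * beta ^+ 2 - beta - 1) / 12;
             (- 8 * beta ^+ 3 - 18 * beta ^+ 2 + 4 * beta + 6) / 12;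
             (12 * beta ^+ 3 + 36 * beta ^+ 2 + 6 * beta - 18) / 12;
             (- 8 * beta ^+ 3 - 30 * beta ^+ 2 - 20 * beta + 10) / 12;
             (2 * beta ^+ 3 + 9 * beta ^+ 2 + 11 * beta + 3) / 12]
  | _ => [::]
  end.

Definition bcoef k beta : seq R :=
  match k with
  | 2 => [:: - (beta - 1); beta]
  | 3 => [:: (beta ^+ 2 - beta) / 2;
             - (beta ^+ 2 - 1);
             (beta ^+ 2 + beta) / 2]
  | 4 => [:: (- beta ^+ 3 + beta) / 6;
             (beta ^+ 3 + beta ^+ 2 - 2 * beta) / 2;
             (- beta ^+ 3 - 2 * beta ^+ 2 + beta + 2) / 2;
             (beta ^+ 3 + 3 * beta ^+ 2 + 2 * beta) / 6]
  | _ => [::]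
  end.

Definition ccoef k beta : seq R :=
  match k with
  | 2 => [:: - beta; beta + 1]
  | 3 => [:: (beta ^+ 2 + beta) / 2;
             - (beta ^+ 2 + 2 * beta);
             (beta ^+ 2 + 3 * beta + 2) / 2]
  | 4 => [:: (- beta ^+ 3 - 3 * beta ^+ 2 - 2 * beta) / 6;
             (beta ^+ 3 + 4 * beta ^+ 2 + 3 * beta) / 2;
             (- beta ^+ 3 - 5 * beta ^+ 2 - 6 * beta) / 2;
             (beta ^+ 3 + 6 * beta ^+ 2 + 11 * beta + 6) / 6]
  | _ => [::]
  end.

Definition eta k beta : R :=
  match k with
  | 2 => (beta - 1) / beta
  | 3 => (beta - 1) / (beta + 1)
  | 4 => (beta - 1) / (beta + 3)
  | _ => 0
  end.

(* [i - k] and [i.+1 - k] are truncated subtractions: Aop is meaningful for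
   i >= k, Bop and Cop for i >= k - 1. *)
Definition Aop (W : lmodType R) k beta (u : nat -> W) (i : nat) : W :=
  \sum_(q < k.+1) (acoef k beta)`_q *: u (i - k + q)%N.

Definition Bop (W : lmodType R) k beta (u : nat -> W) (i : nat) : W :=
  \sum_(q < k) (bcoef k beta)`_q *: u (i.+1 - k + q)%N.

Definition Cop (W : lmodType R) k beta (u : nat -> W) (i : nat) : W :=
  \sum_(q < k) (ccoef k beta)`_q *: u (i.+1 - k + q)%N.

End Coefficients.

(* The dual V'; [l u] is the duality pairing (l, u). *)
Record dual (R : realType) (V : normedModType R) := Dual {
  dual_fun :> {linear V -> R^o};
  dual_continuous : continuous dual_fun }.

(* A real-valued [sup]: to be applied to (differences of) elements of V' only,
   for which the set is bounded. *)
Definition dual_norm (R : realType) (V : normedModType R) (l : V -> R) : R :=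
  sup [set `|l u| / `|u| | u in [set u : V | u != 0]].

Section Setting.
Context {R : realType} {V H : completeNormedModType R}.

(* With completeness, this makes H a Hilbert space for [ip]. *)
Definition hilbert_norm (ip : {dot H for idfun}) : Prop :=
  forall x : H, `|x| = Num.sqrt (ip x x).

Definition dense_embedding (iota : {linear V -> H}) : Prop :=
  [/\ injective iota, continuous iota & dense (range iota)].

(* The last clause says that the norm of V is the energy norm of L; so V is a
   Hilbert space for (u, v) |-> (L u, v). *)
Definition energy_operator (L : V -> dual V) : Prop :=
  [/\ forall v : V, linear (fun u => L u v : R^o),
      forall u v : V, L u v = L v u,
      forall u : V, u != 0 -> 0 < L u u
    & forall u : V, `|u| = Num.sqrt (L u u)].

Definition vball (c : V) : set V := [set v | `|v - c| <= 1].

Variables (iota : {linear V -> H}) (ip : {dot H for idfun}).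
Variables (L G : V -> dual V) (f : R -> dual V) (phi : R -> V).

Definition phi_t (t : R) : H := derive1 (fun s : R => iota (phi s)) t.

(* The equation is an identity in V'; H = H' is embedded in V' by
   h |-> (h, iota _). *)
Definition exact_solution (T : R) : Prop :=
  [/\ {within `[0, T[, continuous phi},
      forall t, 0 < t < T -> derivable (fun s : R => iota (phi s)) t 1
    & forall t, 0 < t < T -> forall v : V,
        ip (phi_t t) (iota v) + L (phi t) v + G (phi t) v = f t v].

Definition locally_lipschitz (gamma mu T : R) : Prop :=
  forall t, 0 <= t <= T -> forall v w : V,
    vball (phi t) v -> vball (phi t) w ->
    dual_norm (fun u => G v u - G w u) ^+ 2
      <= gamma * `|v - w| ^+ 2 + mu * `|iota (v - w)| ^+ 2.

Variables (k : nat) (beta dt : R).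

Definition phi_at (j : nat) : V := phi (j%:R * dt).

(* t^{n+beta} *)
Definition tbeta (n : nat) : R := (n%:R + beta) * dt.

(* [truncE n] is E_k^{n+1}, [truncR n] is R_k^{n+1}, [truncP n] is P_k^n. *)
Definition truncE (n : nat) : H :=
  dt *: phi_t (tbeta n) - iota (Aop k beta phi_at n.+1).

Definition truncR (n : nat) : V :=
  phi (tbeta n) - Bop k beta phi_at n.+1.

Definition truncP (n : nat) : V :=
  phi (tbeta n) - Cop k beta phi_at n.

Definition truncation_bounds (T C0 : R) : Prop :=
  forall n : nat, (k <= n.+1)%N -> n.+1%:R <= T / dt ->
    [/\ `|truncE n| ^+ 2 <= C0 * dt ^+ (2 * k + 2),
        `|truncR n| ^+ 2 <= C0 * dt ^+ (2 * k)
      & `|truncP n| ^+ 2 <= C0 * dt ^+ (2 * k)].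

Variable phin : nat -> V.

Definition err (m : nat) : V := phin m - phi_at m.

Definition initialization (C0 : R) : Prop :=
  [/\ phin 0%N = phi 0,
      forall i : nat, (1 <= i <= k.-1)%N ->
        `|iota (err i)| ^+ 2 <= C0 * dt ^+ (2 * k) /\
        `|err i| ^+ 2 <= C0 * dt ^+ (2 * k)
    & vball (phi (tbeta k.-1)) (Cop k beta phin k.-1)].

Definition imex_scheme (T : R) : Prop :=
  forall n : nat, (k <= n.+1)%N -> n.+1%:R <= T / dt -> forall v : V,
    dt^-1 * ip (iota (Aop k beta phin n.+1)) (iota v)
      + L (Bop k beta phin n.+1) v + G (Cop k beta phin n) v
    = f (tbeta n) v.

End Setting.

(* Main.v *)
(* Let e be the error. The scheme, tested with C e^{n+1}, is controlled by two
   algebraic facts: the form (A e^{n+1}, C e^{n+1}) dominates the increment of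
   a positive definite quadratic energy S of the last k errors (in H), and, for
   D = B - eta C, the form (D e^{n+1}, C e^{n+1}) dominates the increment of a
   positive definite energy S' of the last k - 1 errors (in V). Both are
   inequalities between scalar quadratic forms, which pass to Hilbert spaces
   because a Gram matrix is a sum of rank one matrices. As the extrapolation
   C e^n in the nonlinear term contributes at most
   sqrt gamma (|C e^n|^2 + |C e^{n+1}|^2)/2 up to lower order terms, the
   quantity S + dt S' + dt (sqrt gamma / 2) |C e^n|^2 satisfies a discrete
   Gronwall inequality with a gain of (rho / 2) dt |C e^{n+1}|^2. The resulting
   bound |C e^n|^2 = O(dt^{2k-1}) keeps the extrapolated values in the balls
   where the Lipschitz condition holds, which closes the induction. *)
Require Import Defs.
From mathcomp Require Import ring lra zify.
Local Open Scope ring_scope.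

(** * Quadratic forms in vectors *)

Section QuadraticForms.
Context {R : realType}.
Implicit Types (M N Q T U : nat -> nat -> R) (a c : nat -> R) (t : nat -> R).

(** A common interface for the inner product of H, the energy form of [L] on V, and multiplication
    on R, so that one transfer argument serves all three. *)
Record psd_form (W : lmodType R) (s : W -> W -> R) : Prop := PsdForm {
  psd_linearD : forall x y z, s (x + y) z = s x z + s y z;
  psd_linearZ : forall r x y, s (r *: x) y = r * s x y;
  psd_sym : forall x y, s x y = s y x;
  psd_ge0 : forall x, 0 <= s x x }.

Definition quad (W : lmodType R) (s : W -> W -> R) n M (x : nat -> W) : R :=
  \sum_(i < n) \sum_(j < n) M i j * s (x i) (x j).

Definition scalar_form (u v : R^o) : R := u * v.

Local Notation squad := (quad scalar_form).

Lemma scalar_psd : psd_form scalar_form.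
Proof.
split=> [x y z|r x y|x y|x]; rewrite /scalar_form.
- by rewrite mulrDl.
- by rewrite /GRing.scale/= mulrA.
- by rewrite mulrC.
- by rewrite -expr2 sqr_ge0.
Qed.

Section PsdTheory.
Variables (W : lmodType R) (s : W -> W -> R).
Hypothesis sP : psd_form s.

Lemma psdDr x y z : s x (y + z) = s x y + s x z.
Proof. by rewrite psd_sym// psd_linearD// ![s _ x]psd_sym. Qed.

Lemma psdZr r x y : s x (r *: y) = r * s x y.
Proof. by rewrite psd_sym// psd_linearZ// [s y x]psd_sym. Qed.

Lemma psd0l x : s 0 x = 0.
Proof. by rewrite -(scale0r 0) psd_linearZ// mul0r. Qed.

Lemma psdBl x y z : s (x - y) z = s x z - s y z.
Proof. by rewrite psd_linearD// -scaleN1r psd_linearZ// mulN1r. Qed.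

Lemma psdBr x y z : s x (y - z) = s x y - s x z.
Proof. by rewrite psd_sym// psdBl ![s _ x]psd_sym. Qed.

Lemma psd_suml n (a : nat -> R) (x : nat -> W) y :
  s (\sum_(i < n) a i *: x i) y = \sum_(i < n) a i * s (x i) y.
Proof.
elim: n => [|n IHn]; first by rewrite !big_ord0 psd0l.
by rewrite !big_ord_recr/= psd_linearD// psd_linearZ// IHn.
Qed.

Lemma psd_sumr n (a : nat -> R) (x : nat -> W) y :
  s y (\sum_(i < n) a i *: x i) = \sum_(i < n) a i * s y (x i).
Proof.
by rewrite (psd_sym sP) psd_suml; apply: eq_bigr => i _; rewrite (psd_sym sP).
Qed.

Lemma psd_null x y : s x x = 0 -> s x y = 0.
Proof.
move=> sx0; apply: contrapT => /eqP sxy.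
(* With [s x x = 0], the form at [y - r *: x] is affine in r; this r makes it equal to -1. *)
have := psd_ge0 sP (y - ((s y y + 1) / 2 / s x y) *: x).
rewrite !(psdBl, psdBr) !(psdZr, psd_linearZ sP) sx0 (psd_sym sP y x).
have -> : (s y y + 1) / 2 / s x y * s x y = (s y y + 1) / 2 by field.
lra.
Qed.

Lemma psd_CauchySchwarz x y : s x y ^+ 2 <= s x x * s y y.
Proof.
have [/psd_null ->|sx0] := eqVneq (s x x) 0.
  by rewrite expr0n mulr_ge0 ?psd_ge0.
have := psd_ge0 sP (y - (s x y / s x x) *: x).
rewrite !(psdBl, psdBr) !(psdZr, psd_linearZ sP) (psd_sym sP y x).
have -> : s y y - s x y / s x x * s x y
  - (s x y / s x x * s x y - s x y / s x x * (s x y / s x x * s x x))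
  = (s x x * s y y - s x y ^+ 2) / s x x by field.
have sx_gt0 : 0 < s x x by rewrite lt_neqAle eq_sym sx0 psd_ge0.
by rewrite pmulr_lge0 ?invr_gt0// subr_ge0.
Qed.

Lemma quadS n M x : quad s n.+1 M x =
  M 0%N 0%N * s (x 0%N) (x 0%N)
  + \sum_(i < n) (M 0%N i.+1 + M i.+1 0%N) * s (x 0%N) (x i.+1)
  + quad s n (fun i j => M i.+1 j.+1) (fun i => x i.+1).
Proof.
rewrite /quad big_ord_recl big_ord_recl/= -!addrA; congr (_ + _).
under [X in _ + X = _]eq_bigr do rewrite big_ord_recl/=.
rewrite big_split/= addrA -big_split/=; congr (_ + _).
by apply: eq_bigr => i _; rewrite mulrDl [s (x 0%N) _]psd_sym.
Qed.

End PsdTheory.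

(* Gram matrices are sums of rank one matrices: eliminating one vector at a
   time, as in the Cholesky algorithm, reduces vectors to scalars. *)
Lemma quad_transfer n M : (forall t, 0 <= squad n M t) ->
  forall (W : lmodType R) (s : W -> W -> R), psd_form s ->
  forall x, 0 <= quad s n M x.
Proof.
move=> M_ge0 W s sP x; elim: n M M_ge0 x => [|n IHn] M M_ge0 x.
  by rewrite /quad big_ord0.
pose a i : R := s (x i) (x 0%N); pose p := s (x 0%N) (x 0%N).
(* Projection off [x 0]. If p = 0 the convention [p^-1 = 0] gives y = x, and [psd_null] makes all
   [a i] vanish, so both cases satisfy the same identities. *)
pose y i := x i - (p^-1 * a i) *: x 0%N.
have sE i j : s (x i) (x j) = s (y i) (y j) + p^-1 * (a i * a j).
  rewrite !(psdBl sP, psdBr sP) !(psdZr sP, psd_linearZ sP) (psd_sym sP (x 0%N)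
    (x j)) -/p -/(a i) -/(a j).
  have [p0|p0] := eqVneq p 0; first by rewrite p0 invr0 !mul0r; lra.
  by field.
have y0 j : s (y 0%N) (y j) = 0.
  rewrite !(psdBl sP, psdBr sP) !(psdZr sP, psd_linearZ sP).
  rewrite (psd_sym sP (x 0%N) (x j)) -/(a j) -/p.
  have [p0|p0] := eqVneq p 0.
    have -> : a j = 0 by rewrite /a psd_sym// psd_null.
    by rewrite p0; lra.
  by rewrite -[a 0%N]/p; field.
have -> : quad s n.+1 M x = quad s n.+1 M y + p^-1 * squad n.+1 M a.
  rewrite /quad mulr_sumr -big_split/=; apply: eq_bigr => i _.
  rewrite mulr_sumr -big_split/=; apply: eq_bigr => j _.
  by rewrite sE /scalar_form; ring.
rewrite addr_ge0 ?mulr_ge0 ?invr_ge0 ?psd_ge0// quadS// y0 mulr0 add0r.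
rewrite big1 => [|i _]; last by rewrite y0 mulr0.
rewrite add0r; apply: IHn => t.
(* Vectors with first entry 0 show that the trailing block of [M] is again nonnegative on
   scalars. *)
have := M_ge0 (fun i => if i is i'.+1 then t i' else 0).
rewrite quadS; last exact: scalar_psd.
rewrite {1}/scalar_form mulr0 mulr0 add0r big1 ?add0r//.
by move=> i _; rewrite /scalar_form mul0r mulr0.
Qed.

(** Coercivity with a constant, instead of pointwise positivity: the constant carries over unchanged
    to Hilbert spaces. *)
Definition pd n M := exists2 c : R, 0 < c &
  forall t, c * (\sum_(i < n) t i ^+ 2) <= squad n M t.

Lemma linear_bound n a : exists2 K : R, 0 < K &
  forall t, (\sum_(i < n) a i * t i) ^+ 2 <= K * \sum_(i < n) t i ^+ 2.
Proof.
elim: n => [|n [K K0 IHn]].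
  by exists 1 => // t; rewrite !big_ord0 mulr0 expr0n.
exists (2 * K + 2 * a n ^+ 2) => [|t].
  by apply: ltr_wpDr; [rewrite mulr_ge0 ?sqr_ge0|rewrite mulr_gt0].
rewrite !big_ord_recr/=; have := IHn t.
set S := \sum_(i < n) _; set S2 := \sum_(i < n) t i ^+ 2 => SK.
have S2_ge0 : 0 <= S2 by apply: sumr_ge0 => i _; rewrite sqr_ge0.
have h1 : 0 <= (S - a n * t n) ^+ 2 by rewrite sqr_ge0.
have h2 : 0 <= a n ^+ 2 * S2 by rewrite mulr_ge0 ?sqr_ge0.
have h3 : 0 <= K * t n ^+ 2 by rewrite mulr_ge0 ?sqr_ge0// ltW.
lra.
Qed.

Lemma pd0 M : pd 0 M.
Proof. by exists 1 => // t; rewrite /quad !big_ord0 mulr0. Qed.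

(* One step of fraction-free Gaussian elimination; [l] is a common factor of
   the Schur complement which may be cleared. *)
Lemma pd_step n M N (l : R) : 0 < M 0%N 0%N -> 0 < l ->
  (forall i, (i < n)%N -> M i.+1 0%N = M 0%N i.+1) ->
  (forall i j, (i < n)%N -> (j < n)%N ->
     M 0%N 0%N * M i.+1 j.+1 - M 0%N i.+1 * M 0%N j.+1 = l * N i j) ->
  pd n N -> pd n.+1 M.
Proof.
move=> p0 l0 Msym MN [c c0 cN].
have [K K0 KM] := linear_bound n (fun i => M 0%N i.+1).
set p := M 0%N 0%N in p0 MN *.
(* p times the form is (p t_0 + L)^2 plus l times the reduced form. As p t_0 = (p t_0 + L) - L, the
   bound d <= 1/2 lets the square absorb its share of p^2 t_0^2; the second bound lets the reduced
   form absorb the rest. *)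
pose d := Num.min (1 / 2) (l * c / (2 * K + p ^+ 2)).
have K2_gt0 : 0 < 2 * K + p ^+ 2 by rewrite addr_gt0 ?mulr_gt0 ?exprn_gt0.
have d_gt0 : 0 < d by rewrite lt_min !divr_gt0 ?mulr_gt0.
exists (d * p) => [|t]; first exact: mulr_gt0.
rewrite big_ord_recl/= quadS; last exact: scalar_psd.
set L := \sum_(i < n) M 0%N i.+1 * t i.+1.
set S2 := \sum_(i < n) _ ^+ 2; rewrite -/p.
have -> : \sum_(i < n) (M 0%N i.+1 + M i.+1 0%N) * scalar_form (t 0%N) (t i.+1)
   = 2 * t 0%N * L.
  rewrite mulr_sumr; apply: eq_bigr => i _.
  by rewrite Msym// /scalar_form; ring.
have sq : L ^+ 2 + l * squad n N (fun i => t i.+1) =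
   p * squad n (fun i j => M i.+1 j.+1) (fun i => t i.+1).
  rewrite /quad expr2 mulr_suml !mulr_sumr -big_split/=; apply: eq_bigr => i _.
  rewrite !mulr_sumr -big_split/=; apply: eq_bigr => j _.
  by rewrite !mulrA -MN// /scalar_form; ring.
have := cN (fun i => t i.+1); have := KM (fun i => t i.+1).
rewrite -/L -/S2; move: sq; rewrite [scalar_form (t 0%N) _]/scalar_form.
set A := quad _ _ _ _; set B := quad _ _ _ _ => sq LK cS.
have S2_ge0 : 0 <= S2 by apply: sumr_ge0 => i _; rewrite sqr_ge0.
rewrite -(ler_pM2l p0); rewrite !mulrDr -sq.
have d2 : d <= 1 / 2 by rewrite ge_min lexx.
have dK : d * (2 * K + p ^+ 2) <= l * c.
  by rewrite -ler_pdivlMr// ge_min lexx orbT.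
have h0 : l * (c * S2) <= l * A by rewrite ler_pM2l.
have h1 : d * (2 * K + p ^+ 2) * S2 <= l * c * S2 by rewrite ler_wpM2r.
have h2 : d * L ^+ 2 <= d * (K * S2) by rewrite ler_pM2l.
have h3 : 0 <= d * (p * t 0%N + 2 * L) ^+ 2 by rewrite mulr_ge0 ?sqr_ge0// ltW.
have h4 : d * (p * t 0%N + L) ^+ 2 <= 1 / 2 * (p * t 0%N + L) ^+ 2.
  by rewrite ler_wpM2r ?sqr_ge0.
lra.
Qed.

Lemma quadD (W : lmodType R) (s : W -> W -> R) n M N x :
  quad s n (fun i j => M i j + N i j) x = quad s n M x + quad s n N x.
Proof.
rewrite /quad -big_split/=; apply: eq_bigr => i _.
by rewrite -big_split/=; apply: eq_bigr => j _; rewrite mulrDl.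
Qed.

Lemma quadZ (W : lmodType R) (s : W -> W -> R) n r M x :
  quad s n (fun i j => r * M i j) x = r * quad s n M x.
Proof.
rewrite /quad mulr_sumr; apply: eq_bigr => i _.
by rewrite mulr_sumr; apply: eq_bigr => j _; rewrite mulrA.
Qed.

Lemma quadN (W : lmodType R) (s : W -> W -> R) n M x :
  quad s n (fun i j => - M i j) x = - quad s n M x.
Proof.
rewrite /quad -sumrN; apply: eq_bigr => i _.
by rewrite -sumrN; apply: eq_bigr => j _; rewrite mulNr.
Qed.

Lemma quad_diag (W : lmodType R) (s : W -> W -> R) n r x :
  quad s n (fun i j => (i == j)%:R * r) x = r * \sum_(i < n) s (x i) (x i).
Proof.
rewrite /quad mulr_sumr; apply: eq_bigr => i _.
rewrite (bigD1 i)//= eqxx mul1r big1 ?addr0// => j ji.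
by rewrite eq_sym (negbTE (ji : (val j != val i))) !mul0r.
Qed.

Lemma quad_shift (W : lmodType R) (s : W -> W -> R) n Q x :
  quad s n.+1 (fun i j => if (i, j) is (i'.+1, j'.+1) then Q i' j' else 0) x
  = quad s n Q (fun i => x i.+1).
Proof.
rewrite /quad big_ord_recl/= big1 ?add0r => [|j _]; last by rewrite mul0r.
by apply: eq_bigr => i _; rewrite big_ord_recl/= mul0r add0r.
Qed.

Lemma quad_widen (W : lmodType R) (s : W -> W -> R) n Q x :
  quad s n.+1 (fun i j => if (i < n)%N && (j < n)%N then Q i j else 0) x
  = quad s n Q x.
Proof.
rewrite /quad big_ord_recr/= [X in _ + X]big1 ?addr0 => [|j _].
  apply: eq_bigr => i _; rewrite big_ord_recr/= ltnn andbF mul0r addr0.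
  by apply: eq_bigr => j _; rewrite !ltn_ord.
by rewrite ltnn/= mul0r.
Qed.

Lemma quad_prod (W : lmodType R) (s : W -> W -> R) n a c x : psd_form s ->
  quad s n (fun i j => a i * c j) x
  = s (\sum_(i < n) a i *: x i) (\sum_(i < n) c i *: x i).
Proof.
move=> sP; rewrite psd_suml//; apply: eq_bigr => i _.
rewrite psd_sumr// mulr_sumr; apply: eq_bigr => j _; ring.
Qed.

(** The right side minus the increment is a single quadratic form [M] in n + 1 vectors, with [Q]
    placed once in the trailing and once in the leading block, so [quad_transfer] applies. *)
Lemma balance_transfer n a c Q :
  (forall t, squad n Q (fun i => t i.+1) - squad n Q t
     <= (\sum_(i < n.+1) a i * t i) * (\sum_(i < n.+1) c i * t i)) ->
  forall (W : lmodType R) (s : W -> W -> R), psd_form s -> forall x : nat -> W,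
  quad s n Q (fun i => x i.+1) - quad s n Q x
    <= s (\sum_(i < n.+1) a i *: x i) (\sum_(i < n.+1) c i *: x i).
Proof.
pose M i j := a i * c j
  + (- (if (i, j) is (i'.+1, j'.+1) then Q i' j' else 0)
     + (if (i < n)%N && (j < n)%N then Q i j else 0)).
have ME (W : lmodType R) (s : W -> W -> R) x : psd_form s ->
    quad s n.+1 M x =
    s (\sum_(i < n.+1) a i *: x i) (\sum_(i < n.+1) c i *: x i)
    - (quad s n Q (fun i => x i.+1) - quad s n Q x).
  by move=> sP; rewrite quadD quadD quadN quad_prod// quad_shift quad_widen;
    ring.
move=> Qt W s sP x; rewrite -subr_ge0 -ME//.
apply: quad_transfer => // t; rewrite ME; last exact: scalar_psd.
by rewrite subr_ge0; exact: Qt.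
Qed.

Lemma pd_transfer n Q : pd n Q ->
  exists2 c : R, 0 < c &
  forall (W : lmodType R) (s : W -> W -> R), psd_form s -> forall x : nat -> W,
  c * (\sum_(i < n) s (x i) (x i)) <= quad s n Q x.
Proof.
move=> [c c0 cQ]; exists c => // W s sP x.
rewrite -(quad_diag s n c x) -subr_ge0 -quadN -quadD.
apply: quad_transfer => // t; rewrite quadD quadN quad_diag subr_ge0.
apply: le_trans (cQ t); apply: ler_wpM2l; first exact: ltW.
by apply: ler_sum => i _; rewrite /scalar_form expr2.
Qed.

Definition congr_mx n T N i j : R :=
  \sum_(u < n) \sum_(v < n) T u i * N u v * T v j.

Lemma quad_congr n T N t :
  squad n (congr_mx n T N) t = squad n N (fun i => \sum_(j < n) T i j * t j).
Proof.
rewrite /quad /scalar_form.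
under [RHS]eq_bigr => u _ do under eq_bigr => v _ do
  rewrite mulr_suml mulr_sumr.
under [LHS]eq_bigr => i _ do under eq_bigr => j _ do rewrite mulr_suml.
transitivity (\sum_(u < n) \sum_(v < n) \sum_(i < n) \sum_(j < n)
   T u i * N u v * T v j * (t i * t j)).
  under eq_bigr => i _ do rewrite exchange_big/=.
  rewrite exchange_big/=; apply: eq_bigr => u _.
  under eq_bigr => i _ do under eq_bigr => j _ do rewrite mulr_suml.
  under eq_bigr => i _ do rewrite exchange_big/=.
  by rewrite exchange_big.
apply: eq_bigr => u _; apply: eq_bigr => v _; apply: eq_bigr => i _.
rewrite !mulr_sumr; apply: eq_bigr => j _; ring.
Qed.

(** The left inverse [U] of [T] is bounded, so the squares of the new coordinates control those of
    the old ones. *)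
Lemma pd_congr n T U N :
  (forall t i, (i < n)%N ->
     t i = \sum_(j < n) U i j * \sum_(l < n) T j l * t l) ->
  pd n N -> pd n (congr_mx n T N).
Proof.
move=> TU [c c0 cN].
have bound m : exists2 K : R, 0 < K &
    forall t, \sum_(i < m) (\sum_(j < n) U i j * t j) ^+ 2
      <= K * \sum_(j < n) t j ^+ 2.
  elim: m => [|m [K K0 Km]].
    by exists 1 => // t; rewrite big_ord0 mul1r sumr_ge0// => i _;
      exact: sqr_ge0.
  have [K' K'0 Kn] := linear_bound n (U m).
  exists (K + K') => [|t]; first exact: addr_gt0.
  by rewrite big_ord_recr/= mulrDl lerD.
have [K K0 KU] := bound n; exists (c / K) => [|t]; first exact: divr_gt0.
pose y i := \sum_(j < n) T i j * t j.
rewrite quad_congr; apply: (le_trans _ (cN y)); rewrite -mulrA ler_pM2l//.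
rewrite ler_pdivrMl//; apply: (le_trans _ (KU y)).
by apply: ler_sum => i _; rewrite -TU.
Qed.

Lemma pd_scale n Q (r : R) : 0 < r -> pd n Q -> pd n (fun i j => r * Q i j).
Proof.
move=> r0 [c c0 cQ]; exists (r * c) => [|t]; first exact: mulr_gt0.
by rewrite quadZ -mulrA ler_pM2l.
Qed.

Definition list_mx (l : seq (seq R)) (i j : nat) : R := (nth [::] l i)`_j.

(* [l] lists the rows of the upper triangular part. *)
Fixpoint sym_mx (l : seq (seq R)) (i j : nat) : R :=
  match l, i, j with
  | [::], _, _ => 0
  | r :: _, 0%N, _ => r`_j
  | r :: _, _, 0%N => r`_i
  | _ :: l', i'.+1, j'.+1 => sym_mx l' i' j'
  end.

Lemma pd_sym_step n (r : seq R) l l' (d : R) : 0 < r`_0 -> 0 < d ->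
  (forall i j, (i < n)%N -> (j < n)%N ->
     r`_0 * sym_mx l i j - r`_i.+1 * r`_j.+1 = d * sym_mx l' i j) ->
  pd n (sym_mx l') -> pd n.+1 (sym_mx (r :: l)).
Proof. by move=> r0 d0 rN; apply: pd_step r0 d0 _ rN => -[]. Qed.

(** Multiplied by p, the form is (p u + q v)^2 + (p r - q^2) v^2. *)
Lemma binary_ge0 (p q r u v : R) : 0 < p -> 0 <= p * r - q ^+ 2 ->
  0 <= p * u ^+ 2 + 2 * q * (u * v) + r * v ^+ 2.
Proof.
move=> p0 d0; rewrite -(pmulr_rge0 _ p0).
have : 0 <= (p * u + q * v) ^+ 2 by rewrite sqr_ge0.
have : 0 <= (p * r - q ^+ 2) * v ^+ 2 by rewrite mulr_ge0 ?sqr_ge0.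
lra.
Qed.

End QuadraticForms.

Local Notation squad := (quad scalar_form).

(** * The multiplier identities *)

(** Makes polynomials with nonnegative coefficients accessible to [lra], which treats the powers as
    atoms. *)
Ltac nonneg_powers H :=
  have := exprn_ge0 2 H; have := exprn_ge0 3 H; have := exprn_ge0 4 H;
  have := exprn_ge0 5 H; have := exprn_ge0 6 H; have := exprn_ge0 7 H;
  have := exprn_ge0 8 H; have := exprn_ge0 9 H; have := exprn_ge0 10 H;
  move=> *.

Section Coeffs.
Context {R : realType}.
Implicit Types (t : nat -> R) (beta z : R).

(* Coefficients of D = B - eta C. *)
Definition dcoef k beta : seq R :=
  [seq p.1 - eta k beta * p.2 | p <- zip (bcoef k beta) (ccoef k beta)].

(* Testing [a] with the multiplier [c] yields the increment of a positive
   definite energy of the last [n] values. *)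
Definition dissipative n (a c : seq R) := exists2 Q : nat -> nat -> R, pd n Q &
  forall t, squad n Q (fun i => t i.+1) - squad n Q t
    <= (\sum_(i < n.+1) a`_i * t i) * (\sum_(i < n.+1) c`_i * t i).

(** Clears the denominator that [eta] brings into [dcoef], leaving coefficients polynomial in
    beta. *)
Lemma dissipative_scale n (r : R) (a d c : seq R) : 0 < r ->
  (forall i, (i < n.+1)%N -> d`_i = r * a`_i) ->
  dissipative n a c -> dissipative n d c.
Proof.
move=> r0 da [Q pdQ Qt]; exists (fun i j => r * Q i j) => [|t].
  exact: pd_scale.
have -> : \sum_(i < n.+1) d`_i * t i = r * \sum_(i < n.+1) a`_i * t i.
  by rewrite mulr_sumr; apply: eq_bigr => i _; rewrite da ?mulrA.
by rewrite !quadZ -mulrBr -mulrA ler_pM2l.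
Qed.

(* Backward differences of orders 0, 1, ... at the last point. *)
Let diff2 : seq (seq R) := [:: [:: 0; 1]; [:: -1; 1]].
Let undiff2 : seq (seq R) := [:: [:: 1; -1]; [:: 1; 0]].
Let diff3 : seq (seq R) := [:: [:: 0; 0; 1]; [:: 0; -1; 1]; [:: 1; -2; 1]].
Let undiff3 : seq (seq R) := [:: [:: 1; -2; 1]; [:: 1; -1; 0]; [:: 1; 0; 0]].
Let diff4 : seq (seq R) :=
  [:: [:: 0; 0; 0; 1]; [:: 0; 0; -1; 1]; [:: 0; 1; -2; 1]; [:: -1; 3; -3; 1]].
Let undiff4 : seq (seq R) :=
  [:: [:: 1; -3; 3; -1]; [:: 1; -2; 1; 0]; [:: 1; -1; 0; 0]; [:: 1; 0; 0; 0]].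

Lemma pd_diff2 N : pd 2 N -> pd 2 (congr_mx 2 (list_mx diff2) N).
Proof.
apply: (pd_congr (U := list_mx undiff2)) => t.
by move=> [|[|//]] _; rewrite /list_mx !big_ord_recr !big_ord0/=; ring.
Qed.

Lemma quad_diff2 (p00 p01 p11 : R) t :
  squad 2 (congr_mx 2 (list_mx diff2) (sym_mx [:: [:: p00; p01]; [:: p11]])) t =
    p00 * t 1%N ^+ 2
    + 2 * p01 * (t 1%N * (t 1%N - t 0%N))
    + p11 * (t 1%N - t 0%N) ^+ 2.
Proof.
rewrite quad_congr /quad /list_mx /scalar_form !big_ord_recr !big_ord0/=; ring.
Qed.

Lemma pd_diff3 N : pd 3 N -> pd 3 (congr_mx 3 (list_mx diff3) N).
Proof.
apply: (pd_congr (U := list_mx undiff3)) => t.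
by move=> [|[|[|//]]] _; rewrite /list_mx !big_ord_recr !big_ord0/=; ring.
Qed.

Lemma quad_diff3 (p00 p01 p02 p11 p12 p22 : R) t :
  squad 3 (congr_mx 3 (list_mx diff3)
    (sym_mx [:: [:: p00; p01; p02]; [:: p11; p12]; [:: p22]])) t =
    p00 * t 2%N ^+ 2
    + 2 * p01 * (t 2%N * (t 2%N - t 1%N))
    + 2 * p02 * (t 2%N * (t 2%N - 2 * t 1%N + t 0%N))
    + p11 * (t 2%N - t 1%N) ^+ 2
    + 2 * p12 * ((t 2%N - t 1%N) * (t 2%N - 2 * t 1%N + t 0%N))
    + p22 * (t 2%N - 2 * t 1%N + t 0%N) ^+ 2.
Proof.
rewrite quad_congr /quad /list_mx /scalar_form !big_ord_recr !big_ord0/=; ring.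
Qed.

Lemma pd_diff4 N : pd 4 N -> pd 4 (congr_mx 4 (list_mx diff4) N).
Proof.
apply: (pd_congr (U := list_mx undiff4)) => t.
by move=> [|[|[|[|//]]]] _; rewrite /list_mx !big_ord_recr !big_ord0/=; ring.
Qed.

Lemma quad_diff4 (p00 p01 p02 p03 p11 p12 p13 p22 p23 p33 : R) t :
  squad 4 (congr_mx 4 (list_mx diff4) (sym_mx [:: [:: p00; p01; p02; p03];
    [:: p11; p12; p13]; [:: p22; p23]; [:: p33]])) t =
    p00 * t 3%N ^+ 2
    + 2 * p01 * (t 3%N * (t 3%N - t 2%N))
    + 2 * p02 * (t 3%N * (t 3%N - 2 * t 2%N + t 1%N))
    + 2 * p03 * (t 3%N * (t 3%N - 3 * t 2%N + 3 * t 1%N - t 0%N))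
    + p11 * (t 3%N - t 2%N) ^+ 2
    + 2 * p12 * ((t 3%N - t 2%N) * (t 3%N - 2 * t 2%N + t 1%N))
    + 2 * p13 * ((t 3%N - t 2%N) * (t 3%N - 3 * t 2%N + 3 * t 1%N - t 0%N))
    + p22 * (t 3%N - 2 * t 2%N + t 1%N) ^+ 2
    + 2 * p23 * ((t 3%N - 2 * t 2%N + t 1%N) * (t 3%N - 3 * t 2%N + 3 * t 1%N
      - t 0%N))
    + p33 * (t 3%N - 3 * t 2%N + 3 * t 1%N - t 0%N) ^+ 2.
Proof.
rewrite quad_congr /quad /list_mx /scalar_form !big_ord_recr !big_ord0/=; ring.
Qed.

Lemma pd_elim1 (p00 : R) : 0 < p00 -> pd 1 (sym_mx [:: [:: p00]]).
Proof.
move=> p0; apply: (pd_sym_step (r := [:: p00]) (l' := [::]) p0 ltr01) => //.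
exact: pd0.
Qed.

Lemma pd_elim2 (p00 p01 p11 : R) : 0 < p00 -> 0 < p00 * p11 - p01 ^+ 2 ->
  pd 2 (sym_mx [:: [:: p00; p01]; [:: p11]]).
Proof.
move=> p0 d0.
apply: (pd_sym_step (r := [:: p00; p01]) p0 ltr01 _ (pd_elim1 d0)).
by move=> [|//] [|//] _ _ /=; rewrite mul1r expr2.
Qed.

(** The caller supplies the Schur complement as d times the matrix of the q's, so that elimination
    reduces to checking polynomial identities. *)
Lemma pd_elim3 (p00 p01 p02 p11 p12 p22 d q11 q12 q22 : R) :
  0 < p00 -> 0 < d ->
  p00 * p11 - p01 * p01 = d * q11 ->
  p00 * p12 - p01 * p02 = d * q12 ->
  p00 * p22 - p02 * p02 = d * q22 ->
  pd 2 (sym_mx [:: [:: q11; q12]; [:: q22]]) ->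
  pd 3 (sym_mx [:: [:: p00; p01; p02]; [:: p11; p12]; [:: p22]]).
Proof.
move=> p0 d0 e11 e12 e22 pdq.
apply: (pd_sym_step (r := [:: p00; p01; p02]) p0 d0 _ pdq);
  move=> [|[|//]] [|[|//]] _ _ //=;
  by rewrite [X in _ - X]mulrC.
Qed.

Lemma pd_elim4 (p00 p01 p02 p03 p11 p12 p13 p22 p23 p33 d q11 q12 q13 q22 q23
  q33 : R) :
  0 < p00 -> 0 < d ->
  p00 * p11 - p01 * p01 = d * q11 ->
  p00 * p12 - p01 * p02 = d * q12 ->
  p00 * p13 - p01 * p03 = d * q13 ->
  p00 * p22 - p02 * p02 = d * q22 ->
  p00 * p23 - p02 * p03 = d * q23 ->
  p00 * p33 - p03 * p03 = d * q33 ->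
  pd 3 (sym_mx [:: [:: q11; q12; q13]; [:: q22; q23]; [:: q33]]) ->
  pd 4 (sym_mx [:: [:: p00; p01; p02; p03]; [:: p11; p12; p13]; [:: p22; p23];
    [:: p33]]).
Proof.
move=> p0 d0 e11 e12 e13 e22 e23 e33 pdq.
apply: (pd_sym_step (r := [:: p00; p01; p02; p03]) p0 d0 _ pdq);
  move=> [|[|[|//]]] [|[|[|//]]] _ _ //=;
  by rewrite [X in _ - X]mulrC.
Qed.

(* In the lemmas below [z] is the excess of beta over its lower bound. The
   remainder is a combination of squares of differences: its weights come from
   writing Re A(x) C(1/x), for x = exp(i theta), as a polynomial in
   1 - cos theta, whose powers are squared moduli of powers of 1 - x. The
   matrix of the energy, in the basis of backward differences, is then
   determined; all its leading minors turn out to have positive coefficients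
   in [z]. *)
Lemma dissipativeA2 z : 0 <= z ->
  dissipative 2 (acoef 2 (1 + z)) (0 :: ccoef 2 (1 + z)).
Proof.
move=> z0.
exists (congr_mx 2 (list_mx diff2) (sym_mx
    [:: [:: 2 / 4; (1 + 2 * z) / 4];
    [:: (2 + 5 * z + 2 * z ^+ 2) / 4]])) => [|t].
  apply: pd_diff2.
  by apply: pd_elim2; nonneg_powers z0; lra.
rewrite !quad_diff2 !big_ord_recr !big_ord0/=.
have : 0 <= (2 + 5 * z + 2 * z ^+ 2) / 4 * (t 2%N - 2 * t 1%N + t 0%N) ^+ 2.
  by apply: mulr_ge0 (sqr_ge0 _); nonneg_powers z0; lra.
have : 0 <= (t 2%N - t 1%N) ^+ 2 by rewrite sqr_ge0.
lra.
Qed.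

Lemma dissipativeA3 z : 0 <= z ->
  dissipative 3 (acoef 3 (1 + z)) (0 :: ccoef 3 (1 + z)).
Proof.
move=> z0.
exists (congr_mx 3 (list_mx diff3) (sym_mx
    [:: [:: 12 / 24; (6 + 12 * z) / 24; (4 + 12 * z + 6 * z ^+ 2) / 24];
    [:: (20 + 36 * z + 12 * z ^+ 2) / 24;
      (8 + 28 * z + 24 * z ^+ 2 + 6 * z ^+ 3) / 24];
    [:: (12 + 46 * z + 50 * z ^+ 2 + 21 * z ^+ 3 + 3 * z ^+ 4) / 24]])) => [|t].
  apply: pd_diff3.
  apply: (pd_elim3 (d := 1 / 144) (q11 := 51 + 72 * z)
    (q12 := 18 + 54 * z + 27 * z ^+ 2)
    (q22 := 32 + 114 * z + 102 * z ^+ 2 + 27 * z ^+ 3)); try lra.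
  by apply: pd_elim2; nonneg_powers z0; lra.
rewrite !quad_diff3 !big_ord_recr !big_ord0/=.
have : 0 <= (12 + 46 * z + 50 * z ^+ 2 + 21 * z ^+ 3 + 3 * z ^+ 4) / 24
    * (t 3%N - 3 * t 2%N + 3 * t 1%N - t 0%N) ^+ 2.
  by apply: mulr_ge0 (sqr_ge0 _); nonneg_powers z0; lra.
have : 0 <= (8 + 11 * z + 3 * z ^+ 2) / 12 * (t 3%N - 2 * t 2%N + t 1%N) ^+ 2.
  by apply: mulr_ge0 (sqr_ge0 _); nonneg_powers z0; lra.
have : 0 <= (t 3%N - t 2%N) ^+ 2 by rewrite sqr_ge0.
lra.
Qed.

(* Here Re A(x) C(1/x) = 2 y - y^2/3 + ..., y = 1 - cos theta, and the negative
   term is absorbed in y (2 - y)/3, the symbol of the square of the central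
   difference. Coefficients such as [37 * 1000 + 625] are split because numerals
   are unary. *)
Lemma dissipativeA4 z : 0 <= z ->
  dissipative 4 (acoef 4 (2 + z)) (0 :: ccoef 4 (2 + z)).
Proof.
move=> z0.
exists (congr_mx 4 (list_mx diff4) (sym_mx
    [:: [:: 72 / 144; (108 + 72 * z) / 144;
      (132 + 144 * z + 36 * z ^+ 2) / 144;
      (150 + 210 * z + 90 * z ^+ 2 + 12 * z ^+ 3) / 144];
    [:: (432 + 360 * z + 72 * z ^+ 2) / 144;
      (534 + 666 * z + 270 * z ^+ 2 + 36 * z ^+ 3) / 144;
      (450 + 780 * z + 480 * z ^+ 2 + 126 * z ^+ 3 + 12 * z ^+ 4) / 144];
    [:: (912 + 1404 * z + 798 * z ^+ 2 + 198 * z ^+ 3 + 18 * z ^+ 4) / 144;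
      (900 + 1785 * z + 1350 * z ^+ 2 + 492 * z ^+ 3 + 87 * z ^+ 4
      + 6 * z ^+ 5) / 144];
    [:: (1500 + 3275 * z + 2845 * z ^+ 2 + 1270 * z ^+ 3 + 309 * z ^+ 4
      + 39 * z ^+ 5 + 2 * z ^+ 6) / 144]])) => [|t].
  apply: pd_diff4.
  apply: (pd_elim4 (d := 1 / 576) (q11 := 540 + 288 * z)
    (q12 := 672 + 636 * z + 144 * z ^+ 2)
    (q13 := 450 + 630 * z + 270 * z ^+ 2 + 36 * z ^+ 3)
    (q22 := 1340 + 1752 * z + 756 * z ^+ 2 + 108 * z ^+ 3)
    (q23 := 1250 + 2200 * z + 1380 * z ^+ 2 + 370 * z ^+ 3 + 36 * z ^+ 4)
    (q33 := 2375 + (4 * 1000 + 800) * z + 3715 * z ^+ 2 + 1390 * z ^+ 3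
    + 253 * z ^+ 4 + 18 * z ^+ 5)); try lra.
  apply: (pd_elim3 (d := 72)
    (q11 := 3778 + (6 * 1000 + 628) * z + (4 * 1000 + 372) * z ^+ 2
    + 1290 * z ^+ 3 + 144 * z ^+ 4)
    (q12 := (5 * 1000 + 175) + (11 * 1000 + 645) * z + (10 * 1000 + 165)
    * z ^+ 2 + (4 * 1000 + 314) * z ^+ 3 + 892 * z ^+ 4 + 72 * z ^+ 5)
    (q22 := 15 * 1000 + (37 * 1000 + 625) * z + (38 * 1000 + 175) * z ^+ 2 +
    (20 * 1000 + 110) * z ^+ 3 + (5 * 1000 + 815) * z ^+ 4 + 877 * z ^+ 5
    + 54 * z ^+ 6)); try lra.
  by apply: pd_elim2; nonneg_powers z0; lra.
rewrite !quad_diff4 !big_ord_recr !big_ord0/=.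
have : 0 <= (1500 + 3275 * z + 2845 * z ^+ 2 + 1270 * z ^+ 3 + 309 * z ^+ 4
     + 39 * z ^+ 5 + 2 * z ^+ 6) / 144
    * (t 4%N - 4 * t 3%N + 6 * t 2%N - 4 * t 1%N + t 0%N) ^+ 2.
  by apply: mulr_ge0 (sqr_ge0 _); nonneg_powers z0; lra.
have : 0 <= (84 + 65 * z + 15 * z ^+ 2 + z ^+ 3) / 72
    * (t 4%N - 3 * t 3%N + 3 * t 2%N - t 1%N) ^+ 2.
  by apply: mulr_ge0 (sqr_ge0 _); nonneg_powers z0; lra.
have : 0 <= (t 4%N - t 3%N) ^+ 2 by rewrite sqr_ge0.
have : 0 <= (t 4%N - t 2%N) ^+ 2 by rewrite sqr_ge0.
lra.
Qed.

(** For k = 2 the choice of [eta] cancels the older coefficient, and D e^{n+1} is just e^{n+1} /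
    beta. *)
Lemma dissipativeD2 z : 0 <= z ->
  dissipative 1 (dcoef 2 (1 + z)) (ccoef 2 (1 + z)).
Proof.
move=> z0; have b0 : 0 < 1 + z by lra.
apply: (@dissipative_scale _ (1 + z)^-1 [:: 0; 1]); first by rewrite invr_gt0.
  by move=> [|[|//]] _ /=; field; rewrite gt_eqF.
exists (sym_mx [:: [:: (1 + z) / 2]]) => [|t].
  by apply: pd_elim1; nonneg_powers z0; lra.
rewrite /quad /scalar_form !big_ord_recr !big_ord0/=.
have : 0 <= (1 + z) / 2 * (t 1%N - t 0%N) ^+ 2.
  by apply: mulr_ge0 (sqr_ge0 _); lra.
have : 0 <= t 1%N ^+ 2 by rewrite sqr_ge0.
lra.
Qed.

(* Here the symbol is 2 (1 - (1 + z) y)^2 + c1 y + c2 y^2 with c1, c2 >= 0. *)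
Lemma dissipativeD3 z : 0 <= z ->
  dissipative 2 (dcoef 3 (1 + z)) (ccoef 3 (1 + z)).
Proof.
move=> z0; have b0 : 0 < 2 + z by lra.
apply: (@dissipative_scale _ (2 + z)^-1 [:: 0; - z; 2 + z]).
- by rewrite invr_gt0.
- by move=> [|[|[|//]]] _ /=; field; rewrite gt_eqF//; lra.
exists (congr_mx 2 (list_mx diff2) (sym_mx
    [:: [:: (12 + 6 * z) / 4; (2 * z + 2 * z ^+ 2) / 4];
    [:: (4 + 8 * z + 5 * z ^+ 2 + z ^+ 3) / 4]])) => [|t].
  apply: pd_diff2.
  by apply: pd_elim2; nonneg_powers z0; lra.
rewrite !quad_diff2 !big_ord_recr !big_ord0/=.
have : 0 <= (2 + 4 * z + 3 * z ^+ 2 + z ^+ 3) / 4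
    * (t 2%N - 2 * t 1%N + t 0%N) ^+ 2.
  by apply: mulr_ge0 (sqr_ge0 _); nonneg_powers z0; lra.
have : 0 <= (2 + 3 * z) / 2 * (t 2%N - t 1%N) ^+ 2.
  by apply: mulr_ge0 (sqr_ge0 _); lra.
have : 0 <= (t 1%N + (1 + z) / 2 * (t 2%N - 2 * t 1%N + t 0%N)) ^+ 2.
  by rewrite sqr_ge0.
lra.
Qed.

(* The symbol is 4 (1 - kappa y)^2 + 2 y (p - 4 q y + 4 r y^2), where
   kappa = 3 + 2 z + z^2/3 is chosen so that p r >= q^2; [p], [q], [r] are the
   arguments of [binary_ge0] below. *)
Lemma dissipativeD4 z : 0 <= z ->
  dissipative 3 (dcoef 4 (2 + z)) (ccoef 4 (2 + z)).
Proof.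
move=> z0; have b0 : 0 < 5 + z by lra.
pose b := 2 + z.
apply: (@dissipative_scale _ (5 + z)^-1 [:: (b - b ^+ 3) / 6;
  (b ^+ 3 + 2 * b ^+ 2 - 3 * b) / 2; (6 - b - 4 * b ^+ 2 - b ^+ 3) / 2;
  (6 + 11 * b + 6 * b ^+ 2 + b ^+ 3) / 6]).
- by rewrite invr_gt0.
- by move=> [|[|[|[|//]]]] _ /=; rewrite /b; field; rewrite gt_eqF//; lra.
rewrite {}/b.
exists (congr_mx 3 (list_mx diff3) (sym_mx
    [:: [:: (684 + 252 * z) / 72; (72 + 180 * z + 60 * z ^+ 2) / 72;
      (612 + 690 * z + 252 * z ^+ 2 + 30 * z ^+ 3) / 72];
    [:: (1044 + 1200 * z + 456 * z ^+ 2 + 60 * z ^+ 3) / 72;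
      (72 + 402 * z + 378 * z ^+ 2 + 126 * z ^+ 3 + 14 * z ^+ 4) / 72];
    [:: (1512 + 2790 * z + 2031 * z ^+ 2 + 729 * z ^+ 3 + 129 * z ^+ 4
      + 9 * z ^+ 5) / 72]])) => [|t].
  apply: pd_diff3.
  apply: (pd_elim3 (d := 1 / 72)
    (q11 := (9 * 1000 + 846) + (14 * 1000 + 694) * z + (7 * 1000 + 962)
    * z ^+ 2 + 1866 * z ^+ 3 + 160 * z ^+ 4)
    (q12 := 72 + 1851 * z + 2511 * z ^+ 2 + 1285 * z ^+ 3 + 289 * z ^+ 4
    + 24 * z ^+ 5)
    (q22 := (9 * 1000 + 162) + (20 * 1000 + 67) * z + (18 * 1000 + 163)
    * z ^+ 2 + (8 * 1000 + 694) * z ^+ 3 + 2320 * z ^+ 4 + 327 * z ^+ 5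
    + 19 * z ^+ 6)); try lra.
  by apply: pd_elim2; nonneg_powers z0; lra.
rewrite !quad_diff3 !big_ord_recr !big_ord0/=.
(* The third difference is centered at [t 2 - t 1], so its symbol is -2 y times that of the first
   difference; the binary form in the two thus has the symbol 2 y (p - 4 q y + 4 r y^2). *)
have := @binary_ge0 _ ((57 + 45 * z + 8 * z ^+ 2) / 6)
  ((522 + 678 * z + 321 * z ^+ 2 + 66 * z ^+ 3 + 5 * z ^+ 4) / 36)
  ((1800 + 3630 * z + 2999 * z ^+ 2 + 1299 * z ^+ 3 + 311 * z ^+ 4
    + 39 * z ^+ 5 + 2 * z ^+ 6) / 72)
  (t 2%N - t 1%N) (t 3%N - 3 * t 2%N + 3 * t 1%N - t 0%N).
have -> // : 0 < (57 + 45 * z + 8 * z ^+ 2) / 6 by nonneg_powers z0; lra.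
have d0 : 0 <= (57 + 45 * z + 8 * z ^+ 2) / 6 *
  ((1800 + 3630 * z + 2999 * z ^+ 2 + 1299 * z ^+ 3 + 311 * z ^+ 4
    + 39 * z ^+ 5 + 2 * z ^+ 6) / 72) -
  ((522 + 678 * z + 321 * z ^+ 2 + 66 * z ^+ 3 + 5 * z ^+ 4) / 36) ^+ 2.
  by nonneg_powers z0; lra.
move=> /(_ isT d0).
have : 0 <= (t 2%N + (3 + 2 * z + z ^+ 2 / 3) / 2
    * (t 3%N - 2 * t 2%N + t 1%N)) ^+ 2 by rewrite sqr_ge0.
lra.
Qed.

End Coeffs.

(** * Analytic ingredients *)

(** Heine-Cantor, by the near-covering form of compactness: the radius d tends to 0 from the right,
    and near each point half of its continuity radius works. *)
Lemma segment_uniform_continuity (R : realType) (V : normedModType R)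
    (g : R -> V) (a b e : R) : ({within `[a, b],
      continuous g})%classic -> 0 < e ->
  exists2 d : R, 0 < d & forall x y, a <= x <= b -> a <= y <= b ->
    `|x - y| < d -> `|g x - g y| < e.
Proof.
move=> /subspace_continuousP gC e0.
have /compact_near_coveringP/near_covering_withinP := @segment_compact R a b.
move=> /(_ R (0^'+)%classic (fun d x => forall y, a <= y <= b -> `|x - y| < d ->
  `|g x - g y| < e) _).
case=> [x abx|d /= d0 dP].
  have := gC _ abx; move=> /cvgrPdist_lt/(_ (e / 2)).
  rewrite divr_gt0// => /(_ isT).
  rewrite near_withinE => /nbhs_ballP[r /= r0 rP].
  have r20 : 0 < r / 2 by rewrite divr_gt0.
  exists (ball x (r / 2), [set d | 0 < d < r / 2]%classic) => /=.
    split; first exact: nbhsx_ballx.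
    exists (r / 2) => //= d; rewrite /ball_/= sub0r normrN => dr d0.
    by rewrite d0/= (le_lt_trans _ dr)// ler_norm.
  move=> [x' d] /= [xx' /andP[d0 dr]] abx' y aby xy.
  have h1 : `|g x - g x'| < e / 2.
    by apply: rP => //; apply: le_ball xx'; rewrite ler_pdivrMr//; lra.
  have h2 : `|g x - g y| < e / 2.
    apply: rP; last by rewrite /= in_itv.
    rewrite /ball/=; move: xx'; rewrite /ball/= => xx'.
    have := ler_distD x' x y; lra.
  have := ler_distD (g x) (g x') (g y); rewrite (distrC (g x') (g x)); lra.
exists (d / 2) => [|x y xab yab xy]; first by rewrite divr_gt0.
apply: (dP (d / 2)) => //=.
- by rewrite /ball_/= sub0r normrN gtr0_norm ?divr_gt0// ltr_pdivrMr//; lra.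
- by rewrite divr_gt0.
Qed.

(** A real [sup] bounds its set only if the set is bounded above, which follows here from the
    continuity of the two functionals; v = 0 is outside the set and is treated apart. *)
Lemma dual_norm_bound (R : realType) (V : normedModType R)
    (l1 l2 : dual V) (v : V) :
  `|l1 v - l2 v| <= dual_norm (fun u => l1 u - l2 u) * `|v|.
Proof.
have [->|v0] := eqVneq v 0.
  have l0 (l : dual V) : l 0 = 0 :> R by exact: linear0.
  by rewrite !l0 subr0 !normr0 mulr0.
have bounded (l : dual V) : exists2 r : R, 0 < r &
    forall u : V, `|l u : R| <= r * `|u|.
  have /linear_bounded_continuous/linear_boundedP := @dual_continuous _ _ l.
  by move=> /pinfty_ex_gt0[r r0 lr]; exists r.
have [[r1 r10 lr1] [r2 r20 lr2]] := (bounded l1, bounded l2).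
rewrite -ler_pdivrMr ?normr_gt0//; apply: ub_le_sup; last by exists v.
exists (r1 + r2) => _ [u /= u0 <-].
rewrite ler_pdivrMr ?normr_gt0// mulrDl (le_trans (ler_normB _ _))//.
exact: lerD.
Qed.

(** The recursive inequality is assumed only at those n where the conclusion already holds: in the
    application that bound is what puts the iterate in the ball of the Lipschitz condition. [P] is
    the restriction to times up to T. *)
Lemma discrete_gronwall (R : realType) (w : nat -> R) (i0 : nat)
    (dt lam K0 b : R) (P : nat -> Prop) :
  0 <= dt -> 0 <= lam -> 0 <= b -> 0 <= K0 ->
  w i0 <= K0 ->
  (forall n, P n.+1 -> P n) ->
  (forall n, (i0 <= n)%N -> P n.+1 ->
    w n <= expR (lam * (n%:R * dt)) * (K0 + n%:R * dt * b) ->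
    w n.+1 <= (1 + lam * dt) * w n + dt * b) ->
  forall n, (i0 <= n)%N -> P n ->
    w n <= expR (lam * (n%:R * dt)) * (K0 + n%:R * dt * b).
Proof.
move=> dt0 lam0 b0 K00 w0 PS wS n; elim: n => [|n IHn].
  rewrite leqn0 => /eqP i00 _; rewrite !mul0r mulr0 expR0 mul1r addr0.
  by rewrite -i00.
have ndt m : 0 <= m%:R * dt by rewrite mulr_ge0.
rewrite leq_eqVlt => /predU1P[<- _|i0n Pn].
  apply: (le_trans w0).
  have e1 : 1 <= expR (lam * (i0%:R * dt)).
    by rewrite leNgt expR_lt1 -leNgt mulr_ge0.
  have b1 : 0 <= i0%:R * dt * b by rewrite mulr_ge0.
  apply: (le_trans _ (ler_wpM2r (addr_ge0 K00 b1) e1)).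
  by rewrite mul1r lerDl.
have IH := IHn i0n (PS _ Pn); apply: (le_trans (wS _ i0n Pn IH)).
have lamdt : 0 <= lam * dt by rewrite mulr_ge0.
have e1 : 1 <= expR (lam * (n.+1%:R * dt)).
  by rewrite leNgt expR_lt1 -leNgt mulr_ge0.
have eS : (1 + lam * dt) * expR (lam * (n%:R * dt))
    <= expR (lam * (n.+1%:R * dt)).
  have -> : lam * (n.+1%:R * dt) = lam * dt + lam * (n%:R * dt).
    by rewrite -addn1 natrD; ring.
  by rewrite expRD ler_wpM2r ?expR_ge0// expR_ge1Dx.
have -> : K0 + n.+1%:R * dt * b = (K0 + n%:R * dt * b) + dt * b.
  by rewrite -addn1 natrD; ring.
rewrite mulrDr lerD//; last by rewrite ler_peMl// mulr_ge0.
apply: (@le_trans _ _ ((1 + lam * dt) *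
    (expR (lam * (n%:R * dt)) * (K0 + n%:R * dt * b)))).
  by rewrite ler_wpM2l// addr_ge0.
by rewrite mulrA ler_wpM2r// addr_ge0// mulr_ge0.
Qed.

(* Young's inequality spends half of [(s + rho) z^2] on the three products
   with [z]. *)
Lemma young_step (R : realType) (S0 S1 D0 D1 dt s rho eta x z h E p q d
    ci m c N K : R) :
  0 < dt -> 0 <= s -> 0 < rho -> s + rho <= eta ->
  0 <= x -> 0 <= z -> 0 <= h -> 0 <= m -> 0 <= ci -> 0 <= c -> 0 <= N ->
  E <= c * (dt * N) -> p <= c * N -> q <= c * N ->
  d <= s * (x + p) + m * (h + ci * p) ->
  h ^+ 2 <= K * S0 ->
  S1 - S0 + dt * (D1 - D0) + dt * eta * z ^+ 2
    <= ci * E * z + dt * q * z + dt * d * z ->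
  S1 + dt * D1 + dt * (s / 2) * z ^+ 2 + dt * (rho / 2) * z ^+ 2
  <= S0 + dt * D0 + dt * (s / 2) * x ^+ 2
     + dt * (m ^+ 2 / rho * K * S0
             + (c * (ci + 1 + s + m * ci)) ^+ 2 / rho * N ^+ 2).
Proof.
move=> dt0 s0 rho0 seta x0 z0 h0 m0 ci0 c0 N0 hE hp hq hd hh step.
set a := c * (ci + 1 + s + m * ci).
have rhs : ci * E * z + dt * q * z + dt * d * z
    <= dt * (a * N * z + s * (x * z) + m * h * z).
  have hd' : d <= s * (x + c * N) + m * (h + ci * (c * N)).
    apply: (le_trans hd); apply: lerD; apply: ler_wpM2l => //.
      by rewrite lerD2l.
    by rewrite lerD2l ler_wpM2l.
  have h1 : ci * E * z <= ci * (c * (dt * N)) * z.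
    by rewrite ler_wpM2r// ler_wpM2l.
  have h2 : dt * q * z <= dt * (c * N) * z.
    by rewrite ler_wpM2r// ler_wpM2l// ltW.
  have h3 : dt * d * z <= dt * (s * (x + c * N) + m * (h + ci * (c * N))) * z.
    by rewrite ler_wpM2r// ler_wpM2l// ltW.
  apply: le_trans (lerD (lerD h1 h2) h3) _; rewrite le_eqVlt; apply/orP; left.
  by apply/eqP; rewrite /a; ring.
have young u : u * z <= rho / 4 * z ^+ 2 + u ^+ 2 / rho.
  have -> : rho / 4 * z ^+ 2 + u ^+ 2 / rho =
      u * z + (rho / 2 * z - u) ^+ 2 / rho by field; rewrite gt_eqF.
  by rewrite lerDl divr_ge0 ?sqr_ge0// ltW.
have y1 := young (a * N); have y2 := young (m * h).
have y3 : s * (x * z) <= s * ((x ^+ 2 + z ^+ 2) / 2).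
  rewrite ler_wpM2l//; have := sqr_ge0 (x - z); lra.
have hK : (m * h) ^+ 2 / rho <= m ^+ 2 / rho * K * S0.
  rewrite exprMn mulrAC -[leRHS]mulrA ler_wpM2l//.
  by rewrite divr_ge0 ?sqr_ge0// ltW.
have etaz : dt * (s + rho) * z ^+ 2 <= dt * eta * z ^+ 2.
  by rewrite ler_wpM2r ?sqr_ge0// ler_pM2l.
have tot : dt * (a * N * z + s * (x * z) + m * h * z) <=
  dt * ((rho / 4 * z ^+ 2 + (a * N) ^+ 2 / rho) + s * ((x ^+ 2 + z ^+ 2) / 2)
     + (rho / 4 * z ^+ 2 + m ^+ 2 / rho * K * S0)).
  by rewrite ler_pM2l// !lerD// (le_trans y2)// lerD2l.
have aE : (a * N) ^+ 2 / rho = a ^+ 2 / rho * N ^+ 2 by rewrite exprMn mulrAC.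
rewrite aE in tot.
have := le_trans step (le_trans rhs tot); lra.
Qed.

(** * Energies over a sliding window of values *)

Section Energy.
Context {R : realType}.

Lemma quad_upper n (Q : nat -> nat -> R) : exists2 K : R, 0 < K &
  forall (W : lmodType R) (s : W -> W -> R), psd_form s -> forall x : nat -> W,
    quad s n Q x <= K * \sum_(i < n) s (x i) (x i).
Proof.
exists (1 + \sum_(i < n) \sum_(j < n) `|Q i j|) => [|W s sP x].
  by rewrite ltr_wpDr// sumr_ge0// => i _; rewrite sumr_ge0.
set S := \sum_(i < n) s _ _.
have S_ge0 : 0 <= S by rewrite sumr_ge0// => i _; exact: psd_ge0.
have sS (i : 'I_n) : s (x i) (x i) <= S.
  by rewrite /S (bigD1 i)//= lerDl sumr_ge0// => j _; exact: psd_ge0.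
have sxy (i j : 'I_n) : `|s (x i) (x j)| <= S.
  have := psd_ge0 sP (x i - x j); have := psd_ge0 sP (x i + x j).
  rewrite (psdBl sP) !(psdBr sP) (psd_linearD sP) !(psdDr sP).
  rewrite (psd_sym sP (x j) (x i)).
  have := sS i; have := sS j; rewrite ler_norml => *; apply/andP; split; lra.
rewrite mulrDl mul1r;
  apply: (@le_trans _ _ ((\sum_(i < n) \sum_(j < n) `|Q i j|) * S));
  last by rewrite lerDr.
rewrite mulr_suml; apply: ler_sum => i _; rewrite mulr_suml;
  apply: ler_sum => j _.
by rewrite (le_trans (ler_norm _))// normrM ler_wpM2l.
Qed.

Lemma psd_linear_bound n (a : nat -> R) : exists2 K : R, 0 < K &
  forall (W : lmodType R) (s : W -> W -> R), psd_form s -> forall x : nat -> W,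
    s (\sum_(i < n) a i *: x i) (\sum_(i < n) a i *: x i)
      <= K * \sum_(i < n) s (x i) (x i).
Proof.
have [K K0 KP] := quad_upper n (fun i j => a i * a j).
by exists K => // W s sP x; rewrite -quad_prod//; exact: KP.
Qed.

(** The window ends at [u m] as soon as n <= m + 1, when the truncated subtraction is exact. *)
Definition energy (W : lmodType R) (s : W -> W -> R) n (Q : nat -> nat -> R)
    (u : nat -> W) (m : nat) : R :=
  quad s n Q (fun i => u (m.+1 - n + i)%N).

(** [Q], [c0] and [c1] are chosen before the space, the form and the sequence; this makes the final
    constants independent of the time step. *)
Lemma dissipative_energy n (a c : seq R) : dissipative n a c ->
  exists Q (c0 c1 : R), [/\ 0 < c0, 0 < c1 &
  forall (W : lmodType R) (s : W -> W -> R), psd_form s -> forall u : nat -> W,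
  [/\ forall m, (n <= m.+1)%N ->
        energy s n Q u m.+1 - energy s n Q u m
        <= s (\sum_(i < n.+1) a`_i *: u (m.+1 - n + i)%N)
             (\sum_(i < n.+1) c`_i *: u (m.+1 - n + i)%N),
      forall m, c0 * \sum_(i < n) s (u (m.+1 - n + i)%N) (u (m.+1 - n + i)%N)
        <= energy s n Q u m
    & forall m, energy s n Q u m
        <= c1 * \sum_(i < n) s (u (m.+1 - n + i)%N) (u (m.+1 - n + i)%N)]].
Proof.
move=> [Q pdQ Qt]; have [c0 c00 c0P] := pd_transfer pdQ.
have [c1 c10 c1P] := quad_upper n Q.
exists Q, c0, c1; split=> // W s sP u; split=> m; rewrite /energy.
- move=> nm; have := balance_transfer Qt sP (fun i => u (m.+1 - n + i)%N).
  congr (quad _ _ _ _ - _ <= _); apply/funext => i /=.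
  by rewrite (subSn nm) addSn addnS.
- exact: (c0P _ _ sP (fun i => u (m.+1 - n + i)%N)).
- exact: (c1P _ _ sP (fun i => u (m.+1 - n + i)%N)).
Qed.

Variables (k : nat) (beta : R).
Hypotheses (hk : k \in [:: 2; 3; 4]%N)
  (hbeta : if k == 4%N then 2 <= beta else 1 < beta).

Lemma dissipativeA : dissipative k (acoef k beta) (0 :: ccoef k beta).
Proof.
move: hk hbeta; rewrite !inE => /or3P[]/eqP-> /=.
- have -> : beta = 1 + (beta - 1) by ring.
  by move=> b1; apply: dissipativeA2; lra.
- have -> : beta = 1 + (beta - 1) by ring.
  by move=> b1; apply: dissipativeA3; lra.
- have -> : beta = 2 + (beta - 2) by ring.
  by move=> b1; apply: dissipativeA4; lra.
Qed.

Lemma dissipativeD : dissipative k.-1 (dcoef k beta) (ccoef k beta).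
Proof.
move: hk hbeta; rewrite !inE => /or3P[]/eqP-> /=.
- have -> : beta = 1 + (beta - 1) by ring.
  by move=> b1; apply: dissipativeD2; lra.
- have -> : beta = 1 + (beta - 1) by ring.
  by move=> b1; apply: dissipativeD3; lra.
- have -> : beta = 2 + (beta - 2) by ring.
  by move=> b1; apply: dissipativeD4; lra.
Qed.

Lemma order_gt1 : (1 < k)%N.
Proof. by move: hk; rewrite !inE => /or3P[]/eqP->. Qed.

(** Extrapolation reproduces constants, so its error is controlled by increments of the extrapolated
    function. *)
Lemma sum_ccoef : \sum_(q < k) (ccoef k beta)`_q = 1.
Proof.
by move: hk; rewrite !inE => /or3P[]/eqP->;
  rewrite !big_ord_recl big_ord0/=; lra.
Qed.

(** The leading 0 aligns the k terms of C with the last k of the k + 1 terms of A. *)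
Lemma CopS (W : lmodType R) (u : nat -> W) m : (k <= m.+1)%N ->
  \sum_(i < k.+1) (0 :: ccoef k beta)`_i *: u (m.+1 - k + i)%N
  = Cop k beta u m.+1.
Proof.
move=> km; rewrite big_ord_recl/= scale0r add0r; apply: eq_bigr => i _.
by rewrite (subSn km) addSn addnS.
Qed.

Lemma DopE (W : lmodType R) (u : nat -> W) m :
  \sum_(i < k.-1.+1) (dcoef k beta)`_i *: u (m.+1 - k.-1 + i)%N
  = Bop k beta u m.+1 - eta k beta *: Cop k beta u m.+1.
Proof.
rewrite /Bop /Cop scaler_sumr -sumrB.
move: hk; rewrite !inE => /or3P[]/eqP->;
  by apply: eq_bigr => -[[|[|[|[|//]]]] ?] _ //=; rewrite scalerA scalerBl.
Qed.

Lemma CopE (W : lmodType R) (u : nat -> W) m :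
  \sum_(i < k.-1.+1) (ccoef k beta)`_i *: u (m.+1 - k.-1 + i)%N
  = Cop k beta u m.+1.
Proof. by rewrite /Cop; move: hk; rewrite !inE => /or3P[]/eqP->. Qed.

End Energy.

(** * The error equation *)

Section Error.
Context {R : realType} {V H : completeNormedModType R}.
Variables (ip : {dot H for idfun}) (iota : {linear V -> H}).
Variables (L G : V -> dual V) (f : R -> dual V) (phi : R -> V).
Hypotheses (hH : hilbert_norm ip) (hL : energy_operator L).

Lemma ip_psd : psd_form (fun x y : H => ip x y).
Proof.
split=> [x y z|r x y|x y|x].
- by rewrite linearDl.
- by rewrite linearZl_LR.
- by rewrite hermC expr0 mul1r.
- have [->|x0] := eqVneq x 0; first by rewrite linear0l.
  by rewrite ltW// neq0_dnorm_gt0.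
Qed.

Lemma energy_psd : psd_form (fun u v : V => L u v : R).
Proof.
have [Llin Lsym Lpos Lnorm] := hL.
have L0 v : L 0 v = 0 :> R.
  have := Llin v 1 0 0; rewrite !scale1r addr0 => h.
  by apply: (@addrI _ (L 0 v : R)); rewrite addr0; exact/esym.
split=> [x y z|r x y|x y|x].
- by have := Llin z 1 x y; rewrite !scale1r.
- by have := Llin y r x 0; rewrite !addr0 L0 addr0.
- exact: Lsym.
- by have [->|x0] := eqVneq x 0; [rewrite L0|rewrite ltW// Lpos].
Qed.

Lemma ip_normE x : ip x x = `|x| ^+ 2.
Proof. by rewrite hH sqr_sqrtr// (psd_ge0 ip_psd). Qed.

Lemma energy_normE u : L u u = `|u| ^+ 2 :> R.
Proof.
by have [_ _ _ ->] := hL; rewrite sqr_sqrtr// (psd_ge0 energy_psd).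
Qed.

Lemma ler_form_norm (W : normedModType R) (s : W -> W -> R) : psd_form s ->
  (forall x, s x x = `|x| ^+ 2) -> forall x y, s x y <= `|x| * `|y|.
Proof.
move=> sP sE x y; rewrite (le_trans (ler_norm _))//.
rewrite -ler_sqr ?nnegrE ?mulr_ge0// real_normK ?num_real// exprMn -!sE.
exact: psd_CauchySchwarz.
Qed.

Lemma iota_bounded : dense_embedding iota -> exists2 c : R, 0 < c &
  forall u, `|iota u| <= c * `|u|.
Proof.
move=> [_ /linear_bounded_continuous/linear_boundedP + _].
by move=> /pinfty_ex_gt0[r r0 lr]; exists r.
Qed.

Variables (k : nat) (beta dt : R) (phin : nat -> V).

Lemma Aop_err m : Aop k beta (err phi dt phin) m
  = Aop k beta phin m - Aop k beta (phi_at phi dt) m.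
Proof. by rewrite /Aop -sumrB; apply: eq_bigr => i _; rewrite scalerBr. Qed.

Lemma Bop_err m : Bop k beta (err phi dt phin) m
  = Bop k beta phin m - Bop k beta (phi_at phi dt) m.
Proof. by rewrite /Bop -sumrB; apply: eq_bigr => i _; rewrite scalerBr. Qed.

Lemma Cop_err m : Cop k beta (err phi dt phin) m
  = Cop k beta phin m - Cop k beta (phi_at phi dt) m.
Proof. by rewrite /Cop -sumrB; apply: eq_bigr => i _; rewrite scalerBr. Qed.

Lemma Aop_linear (u : nat -> V) m :
  Aop k beta (fun i => iota (u i)) m = iota (Aop k beta u m).
Proof.
by rewrite /Aop linear_sum; apply: eq_bigr => i _; rewrite linearZ.
Qed.

Lemma Cop_linear (u : nat -> V) m :
  Cop k beta (fun i => iota (u i)) m = iota (Cop k beta u m).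
Proof.
by rewrite /Cop linear_sum; apply: eq_bigr => i _; rewrite linearZ.
Qed.

(** The exact equation at t^{n+beta}, multiplied by [dt], is subtracted from the scheme. That time
    may lie beyond T, hence the second horizon [T1]. *)
Lemma error_equation T T1 n (v : V) :
  dt != 0 -> exact_solution iota ip L G f phi T1 ->
  imex_scheme iota ip L G f k beta dt phin T ->
  (k <= n.+1)%N -> n.+1%:R <= T / dt -> 0 < tbeta beta dt n < T1 ->
  ip (iota (Aop k beta (err phi dt phin) n.+1)) (iota v)
    + dt * L (Bop k beta (err phi dt phin) n.+1) v
  = ip (truncE iota phi k beta dt n) (iota v)
    + dt * L (truncR phi k beta dt n) v
    - dt * (G (Cop k beta phin n) v - G (phi (tbeta beta dt n)) v) :> R.
Proof.
move=> dt0 [_ _ ex] sch kn nT tT; have := ex _ tT v.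
rewrite -(sch n kn nT v) Aop_err Bop_err /truncE /truncR.
rewrite linearB/= !(psdBl ip_psd) (psd_linearZ ip_psd) !(psdBl energy_psd).
set a := ip (iota (Aop k beta phin n.+1)) _.
set g := ip (phi_t _ _ _) _.
move=> e.
have -> : dt * g = a + dt * (L (Bop k beta phin n.+1) v + G (Cop k beta phin n)
  v
   - L (phi (tbeta beta dt n)) v - G (phi (tbeta beta dt n)) v).
  have -> : g = dt^-1 * a + L (Bop k beta phin n.+1) v + G (Cop k beta phin n) v
    - L (phi (tbeta beta dt n)) v - G (phi (tbeta beta dt n)) v :> R.
    by rewrite -e; ring.
  by field.
ring.
Qed.

End Error.

(** * Scalar estimates and index bounds *)

Lemma ler_sum_nat_const (R : realType) n k (F : 'I_n -> R) (b : R) :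
  (n <= k)%N -> 0 <= b -> (forall i, F i <= b) ->
  \sum_(i < n) F i <= k%:R * b.
Proof.
move=> nk b0 Fb; apply: (@le_trans _ _ (n%:R * b)).
  rewrite -[n in leRHS]card_ord mulr_natl -sumr_const.
  exact: ler_sum.
by rewrite ler_wpM2r// ler_nat.
Qed.

Lemma ler_norm_sqrt (R : realType) (C x y : R) : 0 <= y ->
  x ^+ 2 <= C * y ^+ 2 -> x <= Num.sqrt `|C| * y.
Proof.
move=> y0 xy; rewrite (le_trans (ler_norm x))//.
rewrite -ler_sqr ?nnegrE ?mulr_ge0// real_normK ?num_real// exprMn sqr_sqrtr//.
by rewrite (le_trans xy)// ler_wpM2r ?sqr_ge0// ler_norm.
Qed.

Lemma ler_sqrt_sum (R : realType) (g mu x y d : R) :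
  0 <= g -> 0 <= x -> 0 <= y -> d ^+ 2 <= g * x ^+ 2 + mu * y ^+ 2 ->
  d <= Num.sqrt g * x + Num.sqrt `|mu| * y.
Proof.
move=> g0 x0 y0 dxy; rewrite (le_trans (ler_norm d))//.
rewrite -ler_sqr ?nnegrE ?addr_ge0 ?mulr_ge0// real_normK ?num_real//.
rewrite sqrrD !exprMn !sqr_sqrtr//; apply: (le_trans dxy).
have h1 : mu * y ^+ 2 <= `|mu| * y ^+ 2 by
  rewrite ler_wpM2r ?sqr_ge0// ler_norm.
have h2 : 0 <= Num.sqrt g * x * (Num.sqrt `|mu| * y) by rewrite !mulr_ge0.
lra.
Qed.

Lemma window_index n k i : (k.-1 <= n)%N -> (i < k)%N ->
  (n.+1 - k + i <= n)%N /\ (n < n.+1 - k + i + k)%N.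
Proof. by move=> *; split; lia. Qed.

(** * Energy estimate and induction on the time step *)

Theorem theorem3 (R : realType) (k : nat) (hk : k \in [:: 2; 3; 4]%N) :
  exists g_k : R, 0 < g_k /\
  forall (beta : R)
    (hbeta : if k == 4%N then 2 <= beta else 1 < beta)
    (V H : completeNormedModType R)
    (ip : {dot H for idfun}) (iota : {linear V -> H})
    (L G : V -> dual V) (f : R -> dual V) (phi : R -> V)
    (T T1 gamma mu rho C0 : R)
    (hH : hilbert_norm ip)
    (hiota : dense_embedding iota)
    (hL : energy_operator L)
    (hT : 0 < T) (hT1 : T < T1)
    (hphi : exact_solution iota ip L G f phi T1)
    (hgamma : 0 <= gamma)
    (hG : locally_lipschitz iota G phi gamma mu T)
    (hrho : 0 < rho)
    (hstab : rho <= eta k beta - Num.sqrt gamma),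
  exists C dt0 : R, [/\ 0 < C, 0 < dt0 &
    forall dt : R, 0 < dt < dt0 ->
      truncation_bounds iota phi k beta dt T C0 ->
    forall phin : nat -> V,
      initialization iota phi k beta dt phin C0 ->
      imex_scheme iota ip L G f k beta dt phin T ->
    forall m : nat, m%:R <= T / dt ->
      ((k.-1 <= m)%N ->
         vball (phi (tbeta beta dt m)) (Cop k beta phin m)) /\
      g_k * `|iota (err phi dt phin m)| ^+ 2
        + rho / 2 * dt *
          \sum_(k.-1 <= q < m.+1) `|Cop k beta (err phi dt phin) q| ^+ 2
      <= C * expR ((1 - C * dt)^-1 * T) * dt ^+ (2 * k)].
Proof.
(* As [C] may depend on beta, any positive [g_k] will do. *)
exists 1; split=> // beta hbeta V H ip iota L G f phi T T1 gamma mu rho C0 hH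
  hiota hL hT hT1 hphi hgamma hG hrho hstab.
have k_gt1 := order_gt1 hk; have k1 : k.-1.+1 = k by rewrite prednK// ltnW.
have beta0 : 0 < beta by move: hbeta; case: eqP => _; lra.
have ipP := ip_psd ip; have LP := energy_psd hL.
have ipE := ip_normE hH; have LE := energy_normE hL.
have ip_le := ler_form_norm ipP ipE; have L_le := ler_form_norm LP LE.
have [ci ci0 iota_le] := iota_bounded hiota.
have [QA [a0 [a1 [a00 a10 QAP]]]] := dissipative_energy (dissipativeA hk hbeta).
have [QD [d0 [d1 [d00 d10 QDP]]]] := dissipative_energy (dissipativeD hk hbeta).
have [KC KC0 KCP] := psd_linear_bound k (fun q => (ccoef k beta)`_q).
set s := Num.sqrt gamma in hstab; pose m0 := Num.sqrt `|mu|.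
pose c := Num.sqrt `|C0|.
have s0 : 0 <= s by exact: sqrtr_ge0.
have m00 : 0 <= m0 by exact: sqrtr_ge0.
have c0 : 0 <= c by exact: sqrtr_ge0.
(* In units of dt^{2k}: [lam] and [src] are the growth rate and the source delivered by
   [young_step], [K0] bounds the initial energy, and [K] is the resulting Gronwall bound up to time
   T. *)
pose lam := m0 ^+ 2 / rho * (KC / a0).
pose src := (c * (ci + 1 + s + m0 * ci)) ^+ 2 / rho.
pose K0 := (a1 * ci ^+ 2 + d1 + (s / 2 + rho / 2) * KC) * (k%:R * `|C0|).
pose K := expR (lam * T) * (K0 + T * src).
have [[rho_ge0 a0_ge0] a1_ge0] := (ltW hrho, ltW a00, ltW a10).
have [[d1_ge0 KC_ge0] ci_ge0] := (ltW d10, ltW KC0, ltW ci0).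
have lam0 : 0 <= lam by apply: mulr_ge0; apply: divr_ge0 => //; exact: sqr_ge0.
have src0 : 0 <= src by apply: divr_ge0 => //; exact: sqr_ge0.
have K00 : 0 <= K0.
  apply: mulr_ge0; last exact: mulr_ge0.
  apply: addr_ge0; first by apply: addr_ge0 => //; rewrite mulr_ge0 ?sqr_ge0.
  by apply: mulr_ge0 => //; apply: addr_ge0; apply: divr_ge0.
have K_ge0 : 0 <= K.
  apply: mulr_ge0; first exact: expR_ge0.
  by apply: addr_ge0 => //; apply: mulr_ge0 => //; exact: ltW.
(* K / a0 bounds the error in H, K the dissipation sum, and the absolute value of C0 the starting
   values; the final 1 ensures positivity. *)
pose C := (1 / a0 + 1) * K + `|C0| + 1.
have C_gt0 : 0 < C.
  rewrite ltr_wpDl//; apply: addr_ge0 => //; apply: mulr_ge0 => //.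
  by apply: addr_ge0 => //; exact: divr_ge0.
pose sc := \sum_(q < k) `|(ccoef k beta)`_q|.
have sc0 : 0 <= sc by rewrite sumr_ge0.
(* The radius 1 of the balls is spent in quarters. This tolerance for increments of [phi] keeps both
   a single increment and their combination with the weights of C within one quarter. *)
pose e := 1 / 4 / (1 + sc).
have e_gt0 : 0 < e by rewrite !divr_gt0// ltr_wpDr.
have e_le : e <= 1 / 4.
  by rewrite ler_pdivrMr ?ltr_wpDr//; move: sc0; clear; lra.
have sce : sc * e <= 1 / 4.
  by rewrite mulrC /e mulrAC ler_pdivrMr ?ltr_wpDr//; move: sc0; clear; lra.
(* The times t^{n + beta} may exceed T, where neither the Lipschitz condition
   nor (at the last step) the bound on [truncP] is available; the uniform
   continuity of the solution up to T2 > T makes up for that. *)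
pose T2 := (T + T1) / 2.
have T2T : T < T2 by move: hT1; rewrite /T2; clear; lra.
have T2T1 : T2 < T1 by move: hT1; rewrite /T2; clear; lra.
have [om om0 omP] : exists2 om : R, 0 < om & forall x y, 0 <= x <= T2 ->
    0 <= y <= T2 -> `|x - y| < om -> `|phi x - phi y| < e.
  apply: segment_uniform_continuity => //.
  have [+ _ _] := hphi; apply: continuous_subspaceW => x /=.
  by rewrite !in_itv/= => /andP[-> xT2]; rewrite (le_lt_trans xT2).
have kb0 : 0 < k%:R + beta by rewrite ltr_wpDl.
(* In order: dt < 1; 1 - C dt > 0; the nodes of a window lie within [om] of t^{n+beta}; t^{n+beta}
   <= T2; the extrapolated error is at most 1/4; so is [truncP]. *)
pose dt0 := Num.min (Num.min 1 C^-1) (Num.min (om / (k%:R + beta))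
  (Num.min ((T2 - T) / beta)
    (Num.min (rho / (32 * (K + 1))) (1 / 4 / (1 + c))))).
exists C, dt0; split=> //.
  have K1 : 0 < K + 1 by rewrite ltr_wpDl.
  have c1 : 0 < 1 + c by rewrite ltr_wpDr.
  rewrite !lt_min ltr01 invr_gt0 C_gt0 !divr_gt0 ?mulr_gt0//=.
  by rewrite subr_gt0.
move=> dt /andP[dt_gt0];
  rewrite !lt_min => /and5P[/andP[dt1 dtC] dtom dtT2 dtrho dtc].
move=> htr phin hinit hsch.
have dt_ge0 := ltW dt_gt0.
pose N := dt ^+ k.
have N0 : 0 < N by rewrite exprn_gt0.
have N2 : dt ^+ (2 * k) = N ^+ 2 by rewrite mulnC exprM.
have Ndt : N <= dt.
  by rewrite /N -k1 exprS ler_piMr// exprn_ile1// ltW.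
have NN : N ^+ 2 <= dt * dt by rewrite expr2 ler_pM// ltW.
have trunc n : (k <= n.+1)%N -> n.+1%:R <= T / dt ->
    [/\ `|truncE iota phi k beta dt n| <= c * (dt * N),
        `|truncR phi k beta dt n| <= c * N
      & `|truncP phi k beta dt n| <= c * N].
  move=> kn nT; have [hE hR hP] := htr n kn nT; split; apply: ler_norm_sqrt.
  - by rewrite mulr_ge0// ltW.
  - by rewrite exprMn -N2 -exprD addnC.
  - exact: ltW.
  - by rewrite -N2.
  - exact: ltW.
  - by rewrite -N2.
have cN : c * N <= 1 / 4.
  move: dtc; rewrite ltr_pdivlMr ?ltr_wpDr// => h.
  have : c * N <= c * dt by rewrite ler_wpM2l.
  by move: h dt_gt0; clear; lra.
have time n : n%:R <= T / dt -> n%:R * dt <= T by rewrite ler_pdivlMr.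
pose er := err phi dt phin; pose X q := `|Cop k beta er q| ^+ 2.
pose S := energy (fun x y : H => ip x y) k QA (fun i => iota (er i)).
pose D := energy (fun u v : V => L u v : R) k.-1 QD er.
(* [Z] includes the accumulated dissipation, so a bound on [Z] yields both terms of the final
   estimate. *)
pose Z n := S n + dt * D n + dt * (s / 2) * X n
  + dt * (rho / 2) * \sum_(k.-1 <= q < n.+1) X q.
have X_ge0 q : 0 <= X q by exact: sqr_ge0.
have S_ge0 n : 0 <= S n.
  have [_ /(_ n) + _] := QAP _ _ ipP (fun i => iota (er i)).
  apply: le_trans; apply: mulr_ge0 => //; apply: sumr_ge0 => i _.
  exact: (psd_ge0 ipP).
have D_ge0 n : 0 <= D n.
  have [_ /(_ n) + _] := QDP _ _ LP er.
  apply: le_trans; apply: mulr_ge0; first exact: ltW.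
  by apply: sumr_ge0 => i _; exact: (psd_ge0 LP).
have sumX_ge0 n : 0 <= \sum_(k.-1 <= q < n.+1) X q by apply: sumr_ge0.
have SZ n : S n <= Z n.
  rewrite /Z -!addrA lerDl; apply: addr_ge0; first exact: mulr_ge0.
  by apply: addr_ge0; rewrite !mulr_ge0// divr_ge0.
have sumZ n : dt * (rho / 2) * \sum_(k.-1 <= q < n.+1) X q <= Z n.
  rewrite /Z lerDr; apply: addr_ge0; last by rewrite !mulr_ge0// divr_ge0.
  by apply: addr_ge0 => //; exact: mulr_ge0.
have Kbound n : n%:R <= T / dt ->
    expR (lam * (n%:R * dt)) * (K0 * N ^+ 2 + n%:R * dt * (src * N ^+ 2))
    <= K * N ^+ 2.
  move=> /time nT.
  have -> : K0 * N ^+ 2 + n%:R * dt * (src * N ^+ 2)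
    = (K0 + n%:R * dt * src) * N ^+ 2 by ring.
  rewrite mulrA; apply: ler_wpM2r; first exact: sqr_ge0.
  apply: ler_pM; rewrite ?expR_ge0 ?ler_expR//.
  - by apply: addr_ge0 => //; apply: mulr_ge0 => //; apply: mulr_ge0.
  - exact: ler_wpM2l.
  - by rewrite lerD2l ler_wpM2r.
(* One term of the dissipation sum is at most [Z n]. Dividing by dt costs one power, but N^2 <= dt^2
   leaves X n <= 2 K dt / rho <= 1/16. *)
have Xsmall n : (k.-1 <= n)%N -> Z n <= K * N ^+ 2 -> `|Cop k beta er n| <= 1
  / 4.
  move=> kn ZK; have Xsum : X n <= \sum_(k.-1 <= q < n.+1) X q.
    by rewrite big_nat_recr//= lerDr sumr_ge0.
  have h1 : dt * (rho / 2) * X n <= dt * (K * dt).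
    rewrite [leRHS]mulrCA; apply: (@le_trans _ _ (K * N ^+ 2));
      last exact: ler_wpM2l.
    apply: le_trans ZK; apply: le_trans (sumZ n); apply: ler_wpM2l => //.
    by rewrite mulr_ge0// divr_ge0.
  have h2 : rho / 2 * X n <= K * dt by rewrite -(ler_pM2l dt_gt0) mulrA.
  have h3 : K * dt <= rho / 32.
    move: dtrho; rewrite ltr_pdivlMr ?mulr_gt0 ?ltr_wpDl//.
    by move: dt_gt0; clear; lra.
  have h4 : X n <= (1 / 4) ^+ 2.
    rewrite -(ler_pM2l (divr_gt0 hrho (ltr0Sn R 1))).
    by move: h2 h3; clear; lra.
  by rewrite -ler_sqr ?nnegrE.
have tpos n : 0 < tbeta beta dt n.
  by rewrite mulr_gt0// ltr_wpDl.
have tT2 n : n%:R <= T / dt -> tbeta beta dt n <= T2.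
  move=> /time nT; move: dtT2; rewrite ltr_pdivlMr// /tbeta mulrDl.
  by move: nT; clear; lra.
have phi_near n j : n%:R <= T / dt -> (j <= n)%N -> (n < j + k)%N ->
    `|phi_at phi dt j - phi (tbeta beta dt n)| < e.
  move=> nT jn nj; apply: omP.
  - rewrite mulr_ge0//=; have := time _ nT; apply/contraTT; rewrite -!ltNge.
    have : j%:R * dt <= n%:R * dt by rewrite ler_wpM2r// ler_nat.
    by move: T2T; clear; lra.
  - by rewrite tT2// andbT ltW.
  - have -> : j%:R * dt - tbeta beta dt n = - ((n%:R - j%:R + beta) * dt).
      by rewrite /tbeta; ring.
    have jn' : j%:R <= n%:R :> R by rewrite ler_nat.
    rewrite normrN gtr0_norm ?mulr_gt0 ?ltr_wpDl ?subr_ge0//.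
    move: dtom; rewrite ltr_pdivlMr// mulrC; apply: le_lt_trans.
    apply: ler_wpM2r => //; rewrite lerD2r lerBlDl -natrD ler_nat; exact: ltnW.
have Cphi_near n : n%:R <= T / dt -> (k.-1 <= n)%N ->
    `|Cop k beta (phi_at phi dt) n - phi (tbeta beta dt n)| <= 1 / 4.
  move=> nT kn.
  (* Since the weights sum to 1, the difference is a combination of increments of [phi]; this
     argument also covers the last step. *)
  have -> : phi (tbeta beta dt n) =
      \sum_(q < k) (ccoef k beta)`_q *: phi (tbeta beta dt n).
    by rewrite -scaler_suml sum_ccoef// scale1r.
  rewrite /Cop -sumrB; apply: (le_trans (ler_norm_sum _ _ _)).
  apply: (le_trans _ sce); rewrite mulr_suml; apply: ler_sum => i _.
  rewrite -scalerBr normrZ; apply: ler_wpM2l => //; apply: ltW.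
  by have [jn nj] := window_index kn (ltn_ord i); exact: phi_near.
have ball n : n%:R <= T / dt -> (k.-1 <= n)%N -> `|Cop k beta er n| <= 1 / 4 ->
    vball (phi (tbeta beta dt n)) (Cop k beta phin n).
  move=> nT kn x4; have := Cphi_near n nT kn; rewrite /vball/=.
  have -> : Cop k beta phin n - phi (tbeta beta dt n) =
      Cop k beta er n + (Cop k beta (phi_at phi dt) n - phi (tbeta beta dt n)).
    by rewrite Cop_err addrA subrK.
  have := ler_normD (Cop k beta er n)
    (Cop k beta (phi_at phi dt) n - phi (tbeta beta dt n)).
  by move: x4; clear; lra.
(* All terms are estimated through the starting errors in V, the one in H by way of the embedding
   constant; the weights dt are replaced by 1. *)
have Zinit : Z k.-1 <= K0 * N ^+ 2.
  have M0 : 0 <= `|C0| * N ^+ 2 by rewrite mulr_ge0// sqr_ge0.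
  have eb i : (i < k)%N -> `|er i| ^+ 2 <= `|C0| * N ^+ 2.
    case: i => [_|i ik].
      have [phin0 _ _] := hinit.
      by rewrite /er /err phin0 /phi_at mul0r subrr normr0 expr0n.
    have [_ /(_ i.+1) + _] := hinit; rewrite /= -ltnS k1 => /(_ ik)[_].
    by rewrite -/er N2 => /le_trans; apply;
      rewrite ler_wpM2r ?sqr_ge0// ler_norm.
  have idx i : (i < k)%N -> (k.-1.+1 - k + i < k)%N by rewrite k1 subnn.
  have S1 : S k.-1 <= a1 * (k%:R * (ci ^+ 2 * (`|C0| * N ^+ 2))).
    have [_ _ /(_ k.-1)] := QAP _ _ ipP (fun i => iota (er i)).
    move=> /le_trans; apply; apply: ler_wpM2l => //.
    apply: ler_sum_nat_const => //; first by rewrite mulr_ge0// sqr_ge0.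
    move=> [i ik]; rewrite ipE.
    apply: (@le_trans _ _ ((ci * `|er (k.-1.+1 - k + i)%N|) ^+ 2)).
      by rewrite ler_sqr ?nnegrE ?mulr_ge0.
    by rewrite exprMn ler_wpM2l ?sqr_ge0// eb// idx.
  have D1 : D k.-1 <= d1 * (k%:R * (`|C0| * N ^+ 2)).
    have [_ _ /(_ k.-1)] := QDP _ _ LP er.
    move=> /le_trans; apply; apply: ler_wpM2l => //.
    apply: ler_sum_nat_const => //; first by rewrite leq_pred.
    move=> [i ik]; rewrite LE eb// subSn// subnn add1n /=.
    by move: ik; rewrite -ltnS k1.
  have X1 : X k.-1 <= KC * (k%:R * (`|C0| * N ^+ 2)).
    have := KCP _ _ LP (fun i => er (k.-1.+1 - k + i)%N).
    rewrite LE => /le_trans; apply; apply: ler_wpM2l => //.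
    by apply: ler_sum_nat_const => // -[i ik]; rewrite LE eb// idx.
  rewrite /Z big_nat1.
  have D2 : dt * D k.-1 <= D k.-1 by rewrite ler_piMl// ltW.
  have X2 : dt * (s / 2) * X k.-1 + dt * (rho / 2) * X k.-1
      <= (s / 2 + rho / 2) * X k.-1.
    rewrite -mulrDl -mulrDr; apply: ler_wpM2r => //; rewrite ler_piMl//.
      by apply: addr_ge0; exact: divr_ge0.
    exact: ltW.
  have X3 : (s / 2 + rho / 2) * X k.-1
      <= (s / 2 + rho / 2) * (KC * (k%:R * (`|C0| * N ^+ 2))).
    by apply: ler_wpM2l => //; apply: addr_ge0; exact: divr_ge0.
  by rewrite /K0; move: S1 D1 D2 X2 X3; clear; lra.
have nS n : n.+1%:R <= T / dt -> n%:R <= T / dt.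
  by apply: le_trans; rewrite ler_nat.
have step n : (k.-1 <= n)%N -> n.+1%:R <= T / dt ->
    Z n <= expR (lam * (n%:R * dt))
      * (K0 * N ^+ 2 + n%:R * dt * (src * N ^+ 2)) ->
    Z n.+1 <= (1 + lam * dt) * Z n + dt * (src * N ^+ 2).
  move=> kn nT' Zn; have nT := nS _ nT'.
  have kn1 : (k <= n.+1)%N by rewrite -k1 ltnS.
  have Ce := Xsmall n kn (le_trans Zn (Kbound n nT)).
  have [hE hR hP] := trunc n kn1 nT'.
  (* The Lipschitz condition is used in the ball around [phi tau]. *)
  set t := tbeta beta dt n; pose tau := Num.min t T.
  have tauT : 0 <= tau <= T by rewrite le_min ge_min lexx orbT ltW ?tpos//= ltW.
  have t_near : `|phi t - phi tau| < e.
    apply: omP; first by rewrite tT2// ltW// tpos.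
      by case/andP: tauT => -> /le_trans; apply; exact: ltW.
    have tT : t - T < om.
      have := time _ nT'; move: dtom; rewrite ltr_pdivlMr// => h1 h2.
      have -> : t - T = dt * (k%:R + beta) - (T - n.+1%:R * dt) - dt * (k%:R
        + 1).
        by rewrite /t /tbeta -addn1 natrD; ring.
      have : 0 < dt * (k%:R + 1) by rewrite mulr_gt0// ltr_wpDl.
      by move: h1 h2; clear; lra.
    rewrite /tau; case: (leP t T) => tT'; first by rewrite subrr normr0.
    by rewrite gtr0_norm ?subr_gt0.
  have Cp : Cop k beta phin n - phi t = Cop k beta er n
    - truncP phi k beta dt n.
    by rewrite Cop_err /truncP -/t opprB addrA subrK.
  have ball_v : vball (phi tau) (Cop k beta phin n).
    rewrite /vball/=; have -> : Cop k beta phin n - phi tau =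
        (Cop k beta er n - truncP phi k beta dt n) + (phi t - phi tau).
      by rewrite -Cp addrA subrK.
    have := ler_normD (Cop k beta er n - truncP phi k beta dt n) (phi t
      - phi tau).
    have := ler_normB (Cop k beta er n) (truncP phi k beta dt n).
    by move: Ce hP cN t_near e_le; clear; lra.
  have ball_w : vball (phi tau) (phi t) by rewrite /vball/=; move: t_near e_le;
    clear; lra.
  have := hG tau tauT _ _ ball_v ball_w; rewrite Cp.
  set d := dual_norm _ => hd.
  set v := Cop k beta er n.+1.
  pose x := `|Cop k beta er n|; pose p := `|truncP phi k beta dt n|.
  pose h := `|iota (Cop k beta er n)|.
  have d_le : d <= s * (x + p) + m0 * (h + ci * p).
    apply: (le_trans (ler_sqrt_sum hgamma _ _ hd)) => //.
    apply: lerD; apply: ler_wpM2l => //; first exact: ler_normB.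
    rewrite linearB/=; apply: (le_trans (ler_normB _ _)).
    by apply: lerD => //; exact: iota_le.
  have h_le : h ^+ 2 <= KC / a0 * S n.
    have := KCP _ _ ipP (fun i => iota (er (n.+1 - k + i)%N)).
    have -> : \sum_(i < k) (ccoef k beta)`_i *: iota (er (n.+1 - k + i)%N)
      = iota (Cop k beta er n) by rewrite -Cop_linear.
    rewrite ipE => /le_trans; apply.
    rewrite -[leRHS]mulrA ler_wpM2l// ler_pdivlMl//.
    by have [_ /(_ n) + _] := QAP _ _ ipP (fun i => iota (er i)).
  have dSA : S n.+1 - S n
      <= ip (iota (Aop k beta er n.+1)) (iota v).
    have [/(_ n kn1) + _ _] := QAP _ _ ipP (fun i => iota (er i)).
    rewrite (CopS beta (fun i => iota (er i)) kn1) Cop_linear.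
    by rewrite -(Aop_linear iota).
  (* Splitting B = D + eta C isolates the coercive term that must absorb the nonlinearity. *)
  have dSD : D n.+1 - D n <= L (Bop k beta er n.+1) v - eta k beta * `|v| ^+ 2.
    have kn' : (k.-1 <= n.+1)%N by rewrite ltnW// ltnS.
    have [/(_ n kn') + _ _] := QDP _ _ LP er.
    rewrite (DopE beta hk) (CopE beta hk) -/v.
    by rewrite (psdBl LP) (psd_linearZ LP) LE.
  have dt_neq0 : dt != 0 by rewrite gt_eqF.
  have tT1 : 0 < tbeta beta dt n < T1.
    by rewrite tpos/= (le_lt_trans (tT2 _ nT)).
  have eqn := error_equation hL v dt_neq0 hphi hsch kn1 nT' tT1.
  rewrite -/er -/t in eqn.
  have hEv : ip (truncE iota phi k beta dt n) (iota v)
      <= ci * `|truncE iota phi k beta dt n| * `|v|.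
    rewrite (le_trans (ip_le _ _))// mulrAC mulrC ler_wpM2r//.
  have hRv := L_le (truncR phi k beta dt n) v.
  have hGv : - (G (Cop k beta phin n) v - G (phi t) v) <= d * `|v| :> R.
    by rewrite (le_trans _ (dual_norm_bound _ _ _))// -normrN ler_norm.
  have main : S n.+1 - S n + dt * (D n.+1 - D n) + dt * eta k beta * `|v| ^+ 2
    <= ci * `|truncE iota phi k beta dt n| * `|v|
       + dt * `|truncR phi k beta dt n| * `|v| + dt * d * `|v|.
    have h1 := ler_wpM2l dt_ge0 dSD; have h2 := ler_wpM2l dt_ge0 hRv.
    have h3 := ler_wpM2l dt_ge0 hGv.
    by move: h1 h2 h3 eqn dSA hEv; clear; lra.
  have sr : s + rho <= eta k beta by move: hstab; clear; lra.
  have := young_step dt_gt0 s0 hrho sr (normr_ge0 _) (normr_ge0 _) (normr_ge0 _)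
    m00 ci_ge0 c0 (ltW N0) hE hP hR d_le h_le main.
  rewrite -/lam -/src => hZ.
  have lamZ : dt * (lam * S n) <= dt * (lam * Z n).
    by apply: ler_wpM2l => //; exact: ler_wpM2l.
  have ZS : Z n.+1 = S n.+1 + dt * D n.+1 + dt * (s / 2) * `|v| ^+ 2
     + dt * (rho / 2) * `|v| ^+ 2
     + dt * (rho / 2) * \sum_(k.-1 <= q < n.+1) X q.
    by rewrite /Z big_nat_recr ?(leq_trans kn)//= /X -/v; ring.
  rewrite ZS mulrDl mul1r {1}/Z -/x; move: hZ lamZ; rewrite -/x /X -/x.
  by clear; lra.
have Zbound n : (k.-1 <= n)%N -> n%:R <= T / dt -> Z n <= K * N ^+ 2.
  move=> kn nT; apply: (le_trans _ (Kbound n nT)).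
  apply: (discrete_gronwall (P := fun n => n%:R <= T / dt) _ _ _ _ Zinit) => //.
  - by rewrite mulr_ge0 ?sqr_ge0.
  - by rewrite mulr_ge0 ?sqr_ge0.
move=> m mT; split=> [km|].
  by apply: ball => //; apply: Xsmall => //; exact: Zbound.
(* The Gronwall exponential is already part of [K]; the factor in the statement is at least 1
   because C dt < 1. *)
have CE : C * N ^+ 2 <= C * expR ((1 - C * dt)^-1 * T) * N ^+ 2.
  apply: ler_wpM2r; first exact: sqr_ge0.
  apply: ler_peMr; first exact: ltW.
  rewrite leNgt expR_lt1 -leNgt; apply: mulr_ge0; last exact: ltW.
  rewrite invr_ge0 subr_ge0 mulrC -ler_pdivlMr// div1r.
  exact: ltW.
rewrite N2 mul1r; apply: le_trans CE; rewrite -/er.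
have [km|mk] := leqP k.-1 m.
  have ZK := Zbound m km mT.
  have h1 : `|iota (er m)| ^+ 2 <= 1 / a0 * S m.
    rewrite div1r ler_pdivlMl//.
    have [_ /(_ m) + _] := QAP _ _ ipP (fun i => iota (er i)).
    apply: le_trans; rewrite ler_pM2l//.
    (* The last entry of the window is [er m]. *)
    have km1 : (k.-1 < k)%N by rewrite k1.
    rewrite (bigD1 (Ordinal km1))//= ipE.
    have -> : (m.+1 - k + k.-1)%N = m by rewrite -[in X in (_
      - X)%N]k1 subSS subnK.
    by rewrite lerDl sumr_ge0// => i _; exact: (psd_ge0 ipP).
  have h2 : 1 / a0 * S m <= 1 / a0 * (K * N ^+ 2).
    by rewrite ler_wpM2l ?divr_ge0// (le_trans (SZ m)).
  have h3 := le_trans (sumZ m) ZK.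
  have h4 : 0 <= `|C0| * N ^+ 2 by rewrite mulr_ge0 ?sqr_ge0.
  have h5 : 0 <= N ^+ 2 by rewrite sqr_ge0.
  rewrite /C [rho / 2 * dt]mulrC -/X.
  by move: h1 h2 h3 h4 h5; clear; lra.
(* For m < k - 1 the sum is empty, and the starting values alone give the bound; the error at m = 0
   is zero. *)
rewrite big_geq// mulr0 addr0.
have CN : `|C0| * N ^+ 2 <= C * N ^+ 2.
  rewrite ler_wpM2r ?sqr_ge0// /C -addrA addrCA lerDl addr_ge0// mulr_ge0//.
  by rewrite addr_ge0 ?divr_ge0.
apply: le_trans CN.
case: m mT mk => [_ _|m mT mk].
  have [phin0 _ _] := hinit.
  rewrite /er /err phin0 /phi_at mul0r subrr linear0 normr0 expr0n/=.
  by rewrite mulr_ge0 ?sqr_ge0.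
have [_ /(_ m.+1) + _] := hinit; rewrite /= (ltnW mk) => /(_ isT)[+ _].
by rewrite -/er N2 => /le_trans; apply; rewrite ler_wpM2r ?sqr_ge0// ler_norm.
Qed.
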